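(* Let $\mathcal S=\mathcal S(\mathcal P_{\mathbf d},\mathcal X,\mathcal K)$ and $\widehat{\mathcal S}=\mathcal S(\mathcal P_{\mathbf d},\mathcal X,\widehat{\mathcal K})$ be multi-degree spline spaces on $[a,b]$ with the same breakpoints $\mathcal X=\{x_i\}_{i=1}^q$ and degrees $\mathbf d=(d_0,\dots,d_q)$ and with continuity vectors $\mathcal K=(k_1,\dots,k_j,\dots,k_q)$ and $\widehat{\mathcal K}=(k_1,\dots,k_j-1,\dots,k_q)$ for some $j\in\{1,\dots,q\}$. Let $K=\dim\mathcal S$, let $\{N_{i,m}\}_{i=1}^K$ and $\{\hat N_{i,m}\}_{i=1}^{K+1}$ be the MDB-spline bases of $\mathcal S$ and $\widehat{\mathcal S}$, let $\ell$ be the index such that $s_\ell\le x_j<\min(s_{\ell+1},b)$, where $\{s_i\}$ is the left extended partition of $\mathcal S$, and let $\alpha_1,\dots,\alpha_{K+1}$ be the coefficients of reverse knot insertion from $\widehat{\mathcal S}$ to $\mathcal S$, i.e. $\alpha_i=1$ for $i\le\ell-d_j$, $\alpha_i\in\,]0,1[$ for $\ell-d_j+1\le i\le\ell-d_j+k_j$, $\alpha_i=0$ for $i\ge\ell-d_j+k_j+1$, and $$N_{i,m}=\alpha_i\hat N_{i,m}+(1-\alpha_{i+1})\hat N_{i+1,m},\qquad i=1,\dots,K.$$ Let $\{N^{(1)}_i\}_{i=1}^{K-1}$ and $\{\hat N^{(1)}_i\}_{i=1}^{K}$ be the MDB-spline bases of the derivative spaces $D\mathcal S$ and $D\widehat{\mathcal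 S}$, and let $\alpha^{(1)}_i$ be the coefficients of reverse knot insertion from $D\widehat{\mathcal S}$ to $D\mathcal S$. Then $$\alpha_i=\alpha^{(1)}_{i-1}\,\frac{\int_a^b\hat N^{(1)}_{i-1}(x)\,dx}{\int_a^bN^{(1)}_{i-1}(x)\,dx},\qquad i=\ell-d_j+1,\dots,\ell-d_j+k_j.$$
   Context: **Multi-degree spline space.** Let $\mathcal X=\{x_i\}_{i=1}^q$ with $a=x_0<x_1<\dots<x_q<x_{q+1}=b$, $\mathbf d=(d_0,\dots,d_q)$ a vector of nonnegative integers, $\mathcal K=(k_1,\dots,k_q)$ a vector of nonnegative integers with $k_i\le\min\{d_{i-1},d_i\}$. $\mathcal S(\mathcal P_{\mathbf d},\mathcal X,\mathcal K)$ is the set of functions $f$ on $[a,b]$ for which there are polynomials $p_i$ of degree at most $d_i$, $i=0,\dots,q$, with $f=p_i$ on $[x_i,x_{i+1}]$ and $D^\ell p_{i-1}(x_i)=D^\ell p_i(x_i)$ for $\ell=0,\dots,k_i$, $i=1,\dots,q$. Its dimension is $K=d_0+1+\sum_{i=1}^q(d_i-k_i)$. **Extended partitions.** The left extended partition $\mathbf s=\{s_j\}_{j=1}^K$ lists $a$ repeated $d_0+1$ times, then $x_1$ repeated $d_1-k_1$ times, ..., then $x_q$ repeated $d_q-k_q$ times. The right extended partition $\mathbf t=\{t_j\}_{j=1}^K$ lists $x_1$ repeated $d_0-k_1$ times, ..., $x_q$ repeated $d_{q-1}-k_q$ times, then $b$ repeated $d_q+1$ times. Put $s_{K+1}:=b$.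 **MDB-spline basis.** Let $m=\max_i d_i$. For $n=0,\dots,m$ and $i=m+1-n,\dots,K$, the function $N_{i,n}$ is supported on $[s_i,t_{i-m+n}]$ and, on each nontrivial breakpoint interval $[x_j,x_{j+1})\subset[s_i,t_{i-m+n}]$, is given by - $N_{i,n}(x)=1$ if $n=m-d_j$; - $N_{i,n}(x)=\int_{-\infty}^x\big[\delta_{i,n-1}N_{i,n-1}(u)-\delta_{i+1,n-1}N_{i+1,n-1}(u)\big]du$ if $n>m-d_j$; - $N_{i,n}(x)=0$ otherwise, where $\delta_{i,n}=\big(\int_{-\infty}^{+\infty}N_{i,n}(x)\,dx\big)^{-1}$. Functions $N_{i,n}$ that are undefined (index out of range, or $s_i\ge t_{i-m+n}$) are taken to be zero, and for them one sets $\int_{-\infty}^x\delta_{i,n}N_{i,n}(u)\,du:=0$ for $x<s_i$ and $:=1$ for $x\ge s_i$. Values at $b$ are taken as limits from the left. The MDB-spline basis of $\mathcal S$ is $\{N_{i,m}\}_{i=1}^K$. It is known that these functions form a basis of $\mathcal S$, that $N_{i,m}$ vanishes outside $[s_i,t_i]$ and is positive on $(s_i,t_i)$, and that $\sum_iN_{i,m}=1$ on $[a,b]$. All hatted objects are defined in the same way for $\widehat{\mathcal S}$ (dimension $K+1$). **Derivative space.** $D\mathcal S=\{D_+f: f\in\mathcal S\}$, where $D_+$ is the right derivative; it has dimension $K-1$ and is a piecewise (possibly discontinuous) spline space with associated degrees $d_i-1$ and continuities $k_i-1$, which may be negative; its restriction to $[x_i,x_{i+1}]$ is the zero function when $d_i-1<0$.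 Its (piecewise) MDB-spline basis is $N^{(1)}_i:=N_{i+1,m-1}$, $i=1,\dots,K-1$, with $N_{i,m-1}$ from the recurrence above for $\mathcal S$; it is relative to the extended partitions obtained by replacing $d_i,k_i$ with $d_i-1,k_i-1$. Similarly $\hat N^{(1)}_i:=\hat N_{i+1,m-1}$, $i=1,\dots,K$, for $D\widehat{\mathcal S}$. **Reverse knot insertion coefficients (known facts).** In the setting of the claim one has $\mathcal S\subset\widehat{\mathcal S}$, and coefficients $\alpha_1,\dots,\alpha_{K+1}$ with the properties listed in the claim exist. The analogous relation for the derivative spaces (degrees and continuities lowered by one, so that the index $\ell$ becomes $\ell-1$ and $d_j$, $k_j$ become $d_j-1$, $k_j-1$) gives the coefficients $\alpha^{(1)}_1,\dots,\alpha^{(1)}_K$ of reverse knot insertion from $D\widehat{\mathcal S}$ to $D\mathcal S$: $\alpha^{(1)}_i=1$ for $i\le\ell-d_j$, $\alpha^{(1)}_i\in\,]0,1[$ for $\ell-d_j+1\le i\le\ell-d_j+k_j-1$, $\alpha^{(1)}_i=0$ for $i\ge\ell-d_j+k_j$, and $$N^{(1)}_i=\alpha^{(1)}_i\hat N^{(1)}_i+(1-\alpha^{(1)}_{i+1})\hat N^{(1)}_{i+1},\qquad i=1,\dots,K-1.$$ *)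

(* Defs.v *)
From mathcomp Require Import all_boot all_order all_algebra.
From mathcomp Require Import all_classical all_reals all_analysis.
Import Order.TTheory GRing.Theory Num.Theory.
Import numFieldNormedType.Exports.

Set Implicit Arguments.
Unset Strict Implicit.
Unset Printing Implicit Defensive.

Local Open Scope classical_set_scope.
Local Open Scope ring_scope.

(* A multi-degree spline space is given by its breakpoints
   a = x 0 < x 1 < ... < x q < x q.+1 = b, its degrees d 0, ..., d q and its
   continuities k 1, ..., k q.  The sequences are functions on nat, of which
   only these values are ever used. *)
Definition mdspline_data (R : realType) (q : nat) (x : nat -> R)
    (d k : nat -> nat) : Prop :=
  (forall i, (i <= q)%N -> x i < x i.+1) /\
  (forall i, (1 <= i <= q)%N -> (k i <= minn (d i.-1) (d i))%N).

Definition mdspline_maxdeg (q : nat) (d : nat -> nat) : nat :=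
  (\max_(i < q.+1) d i)%N.

Definition mdspline_dim (q : nat) (d k : nat -> nat) : nat :=
  ((d 0%N).+1 + \sum_(1 <= i < q.+1) (d i - k i))%N.

Definition left_partition (R : realType) (q : nat) (x : nat -> R)
    (d k : nat -> nat) : seq R :=
  nseq (d 0%N).+1 (x 0%N) ++ flatten [seq nseq (d i - k i) (x i) | i <- iota 1 q].

Definition right_partition (R : realType) (q : nat) (x : nat -> R)
    (d k : nat -> nat) : seq R :=
  flatten [seq nseq (d i.-1 - k i) (x i) | i <- iota 1 q]
    ++ nseq (d q).+1 (x q.+1).

(* The knots s_i and t_i are numbered from 1.  The default value of nth
   provides the convention s_{K+1} = b. *)
Definition left_knot (R : realType) (q : nat) (x : nat -> R)
    (d k : nat -> nat) (i : nat) : R :=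
  nth (x q.+1) (left_partition q x d k) i.-1.

Definition right_knot (R : realType) (q : nat) (x : nat -> R)
    (d k : nat -> nat) (i : nat) : R :=
  nth (x q.+1) (right_partition q x d k) i.-1.

(* N_{i,n} is defined when m + 1 - n <= i <= K and s_i < t_{i-m+n}. *)
Definition mdb_defined (R : realType) (q : nat) (x : nat -> R)
    (d k : nat -> nat) (n i : nat) : bool :=
  let m := mdspline_maxdeg q d in
  [&& (m < i + n)%N, (i <= mdspline_dim q d k)%N
    & left_knot q x d k i < right_knot q x d k (i + n - m)].

(* int_{-oo}^y delta f, with delta = (int f)^-1, for a defined basis function
   f whose first knot is s; the step function at s for an undefined one. *)
Definition mdb_cumul (R : realType) (is_def : bool) (s : R) (f : R -> R)
    (y : R) : R :=
  if is_def then
    \int[@lebesgue_measure R]_(u in `]-oo, y])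
      ((\int[@lebesgue_measure R]_v f v)^-1 * f u)
  else (s <= y)%R%:R.

(* mdb q x d k n i is N_{i,n}, for n <= m.  The index h below is that of the
   breakpoint interval [x_h, x_{h+1}[ containing y, provided that this interval
   lies in [s_i, t_{i-m+n}]. *)
Fixpoint mdb (R : realType) (q : nat) (x : nat -> R) (d k : nat -> nat)
    (n i : nat) (y : R) {struct n} : R :=
  let m := mdspline_maxdeg q d in
  let s := left_knot q x d k in
  let t := right_knot q x d k in
  let piece (z : R) : R :=
    if [pick h : 'I_q.+1 | [&& s i <= x h, x h <= z < x h.+1
                             & x h.+1 <= t (i + n - m)%N]] is Some h then
      if n == (m - d h)%N then 1
      else if (m - d h < n)%N then
        if n is n'.+1 then
          mdb_cumul (mdb_defined q x d k n' i) (s i)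
            (mdb q x d k n' i) z
          - mdb_cumul (mdb_defined q x d k n' i.+1) (s i.+1)
              (mdb q x d k n' i.+1) z
        else 0
      else 0
    else 0 in
  if mdb_defined q x d k n i then
    if y == x q.+1 then lim (piece z @[z --> (x q.+1)^'-]) else piece y
  else 0.

Definition mdb_basis (R : realType) (q : nat) (x : nat -> R)
    (d k : nat -> nat) (i : nat) : R -> R :=
  mdb q x d k (mdspline_maxdeg q d) i.

(* The MDB-spline basis N^(1)_i = N_{i+1,m-1} of the derivative space. *)
Definition mdb_deriv_basis (R : realType) (q : nat) (x : nat -> R)
    (d k : nat -> nat) (i : nat) : R -> R :=
  mdb q x d k (mdspline_maxdeg q d).-1 i.+1.

(* alpha_1, ..., alpha_{K+1} are the coefficients of reverse knot insertion
   from the basis Nhat_1, ..., Nhat_{K+1} to the basis N_1, ..., N_K on [a, b],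
   where dj and kj are the degree and continuity at the knot x_j and l is the
   index such that s_l <= x_j < min(s_{l+1}, b).  The bounds l - dj and
   l - dj + kj on i are written additively to avoid truncated subtraction. *)
Definition reverse_knot_insertion (R : realType) (a b : R) (K l dj kj : nat)
    (N Nhat : nat -> R -> R) (alpha : nat -> R) : Prop :=
  [/\ forall i, (1 <= i <= K.+1)%N -> (i + dj <= l)%N -> alpha i = 1,
      forall i, (1 <= i <= K.+1)%N -> (l < i + dj <= l + kj)%N ->
        0 < alpha i < 1,
      forall i, (1 <= i <= K.+1)%N -> (l + kj < i + dj)%N -> alpha i = 0 &
      forall i, (1 <= i <= K)%N -> forall y, y \in `[a, b] ->
        N i y = alpha i * Nhat i y + (1 - alpha i.+1) * Nhat i.+1 y].

(* Main.v *)
Require Import Defs.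
From mathcomp Require Import all_boot all_order all_algebra.
From mathcomp Require Import all_classical all_reals all_analysis.
From mathcomp Require Import measurable_realfun zify ring lra.
Import Order.TTheory GRing.Theory Num.Theory.
Import numFieldNormedType.Exports.

(* Write N_{i,m} = C_i - C_{i+1}, where C_i is the normalised primitive of
   N_{i,m-1} = N^(1)_{i-1}.  Summing the insertion relations from i on
   telescopes to C_i = alpha_i Chat_i + (1 - alpha_i) Chat_{i+1}.  Integrating
   the relation between the derivative bases gives, with w, u, v the integrals
   of N^(1)_{i-1}, Nhat^(1)_{i-1}, Nhat^(1)_i,
     w C_i = alpha^(1)_{i-1} u Chat_i + (1 - alpha^(1)_i) v Chat_{i+1}
   and w = alpha^(1)_{i-1} u + (1 - alpha^(1)_i) v.  The difference is
   (w alpha_i - u alpha^(1)_{i-1}) Nhat_{i,m} = 0.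

   The integrals must be nonzero, that is, the N_{i,n} must be nonnegative and
   not zero.  A combination of r consecutive N_{i,n} has at most r - 1 sign
   changes: this goes up in n by Rolle's theorem in integral form, after
   splitting the combination where some N_{i,n-1} is undefined.  So each
   N_{i,n} has a constant sign.  At the left end of its support it is positive
   and dominates N_{i+1,n}, again by induction on n. *)

Set Implicit Arguments.
Unset Strict Implicit.
Unset Printing Implicit Defensive.

Local Open Scope classical_set_scope.
Local Open Scope ring_scope.

(** * Knots and supports *)

Section Knots.
Context {R : realType} (q : nat) (x : nat -> R) (d k : nat -> nat).
Hypothesis hS : mdspline_data q x d k.

Local Notation I h := (mdspline_dim h d k).
Local Notation m := (mdspline_maxdeg q d).
Local Notation s := (left_knot q x d k).
Local Notation t := (right_knot q x d k).

(** The number of right knots that are at most x_h, as [mdspline_dim] at h is the number of left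
    knots that are at most x_h. *)
Definition right_count (h : nat) : nat :=
  (\sum_(1 <= i < h.+1) (d i.-1 - k i))%N.
Local Notation T h := (right_count h).

(** By induction on h: passing x_{h+1} adds d_{h+1} - k_{h+1} left knots and d_h - k_{h+1} right
    ones, and the bound on k keeps both subtractions exact. At the top level, d_h + 1 functions live
    on the interval number h. *)
Lemma left_rightE h : (h <= q)%N -> I h = (T h + (d h).+1)%N.
Proof.
rewrite /mdspline_dim /right_count.
elim: h => [|h IH] hq; first by rewrite !big_geq ?addn0.
have := IH (ltnW hq).
rewrite !(@big_nat_recr _ _ _ h.+1)//=.
have := hS.2 h.+1 hq; rewrite /= => ?; lia.
Qed.

Lemma breakpoint_lt g h : (g < h)%N -> (h <= q.+1)%N -> x g < x h.
Proof.
elim: h => // h IH; rewrite ltnS leq_eqVlt => /orP[/eqP->|gh] hq.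
  exact: hS.1.
by apply: lt_trans (hS.1 h hq); apply: IH => //; lia.
Qed.

Lemma breakpoint_le g h : (g <= h)%N -> (h <= q.+1)%N -> x g <= x h.
Proof.
rewrite leq_eqVlt => /orP[/eqP->//|gh] hq; exact/ltW/breakpoint_lt.
Qed.

Lemma breakpoint_le_last h : (h <= q)%N -> x h.+1 <= x q.+1.
Proof. by move=> hq; apply: breakpoint_le. Qed.

Lemma left_count_le g h : (g <= h)%N -> (I g <= I h)%N.
Proof.
move=> gh; rewrite /mdspline_dim leq_add2l.
by rewrite (@big_cat_nat _ _ _ g.+1 1 h.+1)//= leq_addr.
Qed.

Lemma right_count_le g h : (g <= h)%N -> (T g <= T h)%N.
Proof.
move=> gh; rewrite /right_count.
by rewrite (@big_cat_nat _ _ _ g.+1 1 h.+1)//= leq_addr.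
Qed.

Lemma size_flatten_nseq (e : nat -> nat) (v : nat -> R) g h :
  size (flatten [seq nseq (e i) (v i) | i <- iota g h])
  = (\sum_(g <= i < g + h) e i)%N.
Proof.
elim: h g => [|h IH] g; first by rewrite addn0 big_geq.
by rewrite /= size_cat size_nseq IH [RHS]big_ltn ?addSnnS//; lia.
Qed.

Lemma mem_flatten_nseq (e : nat -> nat) (v : nat -> R) g h y :
  y \in flatten [seq nseq (e i) (v i) | i <- iota g h] ->
  exists2 i, (g <= i < g + h)%N & y = v i.
Proof.
move=> /flattenP[l /mapP[i]]; rewrite mem_iota => hi -> /nseqP[-> _].
by exists i.
Qed.

(** Cutting the partition after x_h leaves exactly I h entries in front. With the next three lemmas,
    comparing a knot with a breakpoint becomes comparing an index with a count. *)
Lemma left_knot_le h i : (h <= q)%N -> (0 < i <= I h)%N -> s i <= x h.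
Proof.
move=> hq /andP[i0 iI]; rewrite /left_knot /left_partition.
have -> : iota 1 q = iota 1 h ++ iota h.+1 (q - h) by rewrite -iotaD subnKC.
rewrite map_cat flatten_cat catA nth_cat size_cat size_nseq size_flatten_nseq.
rewrite add1n prednK//.
rewrite -/(I h) iI.
have : nth (x q.+1) (nseq (d 0%N).+1 (x 0%N) ++
    flatten [seq nseq (d i - k i) (x i) | i <- iota 1 h]) i.-1
  \in (nseq (d 0%N).+1 (x 0%N) ++
    flatten [seq nseq (d i - k i) (x i) | i <- iota 1 h]).
  by apply: mem_nth; rewrite size_cat size_nseq size_flatten_nseq add1n prednK.
rewrite mem_cat => /orP[/nseqP[-> _]|/mem_flatten_nseq[g hg ->]].
  by apply: breakpoint_le => //; lia.
by apply: breakpoint_le; lia.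
Qed.

Lemma left_knot_ge h i : (h <= q)%N -> (I h < i)%N -> x h.+1 <= s i.
Proof.
move=> hq iI; rewrite /left_knot /left_partition.
have -> : iota 1 q = iota 1 h ++ iota h.+1 (q - h) by rewrite -iotaD subnKC.
rewrite map_cat flatten_cat catA nth_cat size_cat size_nseq size_flatten_nseq.
rewrite add1n -/(I h) ltnNge (_ : (I h <= i.-1)%N) /=; last by lia.
set L := flatten _; set z := (X in nth _ _ X).
(* Past the end of the list the default value b satisfies the bound too. *)
have [zL|zL] := ltnP z (size L); last first.
  by rewrite nth_default//; apply: breakpoint_le.
have /mem_flatten_nseq[g hg ->] := mem_nth (x q.+1) zL.
by apply: breakpoint_le; lia.
Qed.

Lemma right_knot_le h i : (h <= q)%N -> (0 < i <= T h)%N -> t i <= x h.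
Proof.
move=> hq /andP[i0 iI]; rewrite /right_knot /right_partition.
have -> : iota 1 q = iota 1 h ++ iota h.+1 (q - h) by rewrite -iotaD subnKC.
rewrite map_cat flatten_cat -catA nth_cat size_flatten_nseq.
rewrite add1n prednK// -/(T h) iI.
have : nth (x q.+1) (flatten [seq nseq (d i.-1 - k i) (x i) | i <- iota 1 h])
    i.-1
  \in flatten [seq nseq (d i.-1 - k i) (x i) | i <- iota 1 h].
  by apply: mem_nth; rewrite size_flatten_nseq add1n prednK.
by move=> /mem_flatten_nseq[g hg ->]; apply: breakpoint_le; lia.
Qed.

Lemma right_knot_ge h i : (h <= q)%N -> (T h < i)%N -> x h.+1 <= t i.
Proof.
move=> hq iI; rewrite /right_knot /right_partition.
have -> : iota 1 q = iota 1 h ++ iota h.+1 (q - h) by rewrite -iotaD subnKC.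
rewrite map_cat flatten_cat -catA nth_cat size_flatten_nseq.
rewrite add1n -/(T h) ltnNge (_ : (T h <= i.-1)%N) /=; last by lia.
set L := _ ++ _; set z := (X in nth _ _ X).
have [zL|zL] := ltnP z (size L); last first.
  by rewrite nth_default//; apply: breakpoint_le.
have := mem_nth (x q.+1) zL.
rewrite mem_cat -/(nseq (d q).+1 _).
move=> /orP[/mem_flatten_nseq[g hg ->]|/(@nseqP _ (d q).+1)[-> _]].
  by apply: breakpoint_le; lia.
exact: breakpoint_le.
Qed.

Lemma maxdeg_ge h : (h <= q)%N -> (d h <= m)%N.
Proof.
move=> hq; rewrite /mdspline_maxdeg.
have hq' : (h < q.+1)%N by [].
exact: (@leq_bigmax _ (fun i : 'I_q.+1 => d i) (Ordinal hq')).
Qed.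

(* [x h, x h.+1] lies in the support of N_{i,n}. *)
Definition covers (n i h : nat) : bool :=
  [&& (h <= q)%N, (T h + m < i + n)%N & (i <= I h)%N].

Lemma coversE n i h : (h <= q)%N -> (m < i + n)%N -> (0 < i)%N ->
  (s i <= x h) && (x h.+1 <= t (i + n - m)) = covers n i h.
Proof.
move=> hq min i0; rewrite /covers hq /=.
have [iI|iI] := leqP i (I h); last first.
  rewrite andbF leNgt (lt_le_trans _ (left_knot_ge hq iI))//.
  exact: breakpoint_lt.
rewrite left_knot_le ?i0//= andbT.
have [iT|iT] := ltnP (T h + m) (i + n).
  by rewrite right_knot_ge//; lia.
rewrite leNgt (le_lt_trans (@right_knot_le h _ hq _))//; first by lia.
exact: breakpoint_lt.
Qed.

(** The witness is the least h with i <= I h, the interval that starts at s_i. Were the right knot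
    among the first T h ones, it would be at most x_h <= s_i, against s_i < t_{i+n-m}. *)
Lemma mdb_defP n i : (n <= m)%N ->
  reflect (exists h, covers n i h) (mdb_defined q x d k n i).
Proof.
move=> nm; rewrite /mdb_defined; apply: (iffP and3P) => [[min iK st]|[h]].
  have i0 : (0 < i)%N by lia.
  have exI : exists h, (i <= I h)%N by exists q.
  case: (ex_minnP exI) => h iI hmin.
  have hq : (h <= q)%N by exact: hmin.
  exists h; rewrite /covers hq iI andbT ltnNge; apply/negP => iT.
  have th : t (i + n - m) <= x h by apply: right_knot_le => //; lia.
  move: st; rewrite ltNge => /negP; apply; apply: le_trans th _.
  case: h iI hmin hq iT => [|h] iI hmin hq iT.
    by move: iT; rewrite /right_count big_geq//; lia.
  apply: left_knot_ge; first by lia.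
  by rewrite ltnNge; apply/negP => /hmin; rewrite ltnn.
move=> /and3P[hq hT hI]; have i0 : (0 < i)%N by lia.
split; first by lia.
  exact: leq_trans hI (left_count_le hq).
apply: (@le_lt_trans _ _ (x h)); first by apply: left_knot_le; rewrite ?i0.
apply: (lt_le_trans (hS.1 h hq)); apply: right_knot_ge => //; lia.
Qed.

Lemma breakpoint_interval y : x 0%N <= y < x q.+1 ->
  exists2 h, (h <= q)%N & x h <= y < x h.+1.
Proof.
move=> /andP[xy yx].
have ex : exists h, y < x h.+1 by exists q.
case: (ex_minnP ex) => h yh hmin; exists h; first exact: hmin.
rewrite yh andbT; case: h {yh} hmin => // h hmin.
by rewrite leNgt; apply/negP => /hmin; rewrite ltnn.
Qed.

Lemma breakpoint_interval_inj g h y : (g <= q)%N -> (h <= q)%N ->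
  x g <= y < x g.+1 -> x h <= y < x h.+1 -> g = h.
Proof.
move=> gq hq /andP[gy yg] /andP[hy yh].
apply/eqP; rewrite eqn_leq; apply/andP; split; rewrite leqNgt; apply/negP => gh.
  have := @breakpoint_le h.+1 g gh (leqW gq); lra.
have := @breakpoint_le g.+1 h gh (leqW hq); lra.
Qed.

Lemma left_knot_step h i y : (h <= q)%N -> (0 < i)%N -> x h <= y < x h.+1 ->
  (s i <= y) = (i <= I h)%N.
Proof.
move=> hq i0 /andP[hy yh]; have [iI|iI] := leqP i (I h).
  by apply: le_trans hy; apply: left_knot_le; rewrite ?i0.
by apply/negbTE; rewrite -ltNge (lt_le_trans yh)// left_knot_ge.
Qed.

End Knots.

(** * The recurrence on one breakpoint interval *)

Section StructureFormula.
Context {R : realType} (q : nat) (x : nat -> R) (d k : nat -> nat).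
Hypothesis hS : mdspline_data q x d k.

Local Notation I h := (mdspline_dim h d k).
Local Notation m := (mdspline_maxdeg q d).
Local Notation s := (left_knot q x d k).
Local Notation t := (right_knot q x d k).
Local Notation T h := (right_count d k h).
Local Notation N := (mdb q x d k).

(* The functions whose differences are the N_{i,n}.  At n = 0 the step
   functions are those of the convention for undefined N_{i,-1}. *)
Definition cumul (n i : nat) (y : R) : R :=
  if n is n'.+1 then
    mdb_cumul (mdb_defined q x d k n' i) (s i) (N n' i) y
  else (s i <= y)%R%:R.
Local Notation C := cumul.

(** The local function [piece] of [mdb]. At n = 0 the branch with the difference is never reached,
    so [cumul] can be used there for every n. *)
Definition mdb_piece (n i : nat) (z : R) : R :=
  if [pick h : 'I_q.+1 | [&& s i <= x h, x h <= z < x h.+1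
                           & x h.+1 <= t (i + n - m)%N]] is Some h then
    if n == (m - d h)%N then 1
    else if (m - d h < n)%N then C n i z - C n i.+1 z else 0
  else 0.

Lemma mdbE n i y : N n i y =
  if mdb_defined q x d k n i then
    if y == x q.+1 then lim (mdb_piece n i z @[z --> (x q.+1)^'-])
    else mdb_piece n i y
  else 0.
Proof. by case: n. Qed.

(** The third case of the recurrence disappears: T h + m < i + n and i <= I h = T h + d_h + 1 give m
    - d_h <= n. *)
Lemma mdb_pieceE n i h y : (h <= q)%N -> (m < i + n)%N -> (0 < i)%N ->
  x h <= y < x h.+1 -> mdb_piece n i y =
  if covers q d k n i h then
    if n == (m - d h)%N then 1 else C n i y - C n i.+1 y
  else 0.
Proof.
move=> hq min i0 hy; rewrite /mdb_piece -(coversE hS)//.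
case: pickP => [g /and3P[sg gy tg]|/(_ (inord h))]; last first.
  by rewrite inordK// hy /= => ->.
have gq : (g <= q)%N by rewrite -ltnS.
have gh : (g : nat) = h := breakpoint_interval_inj hS gq hq gy hy.
rewrite -gh sg tg /=; case: eqVneq => // nm.
have : covers q d k n i h by rewrite -(coversE hS)// -gh sg.
rewrite gh /covers (left_rightE hS)// => H.
by rewrite ifT//; move: nm; rewrite gh; lia.
Qed.

Lemma mdb_piece_out n i y : ~~ (x 0%N <= y < x q.+1) -> mdb_piece n i y = 0.
Proof.
move=> yab; rewrite /mdb_piece; case: pickP => // g /and3P[_ gy _].
case/negP: yab; have gq : (g <= q)%N by rewrite -ltnS.
have := breakpoint_le hS (leq0n g) (leqW gq).
have := breakpoint_le_last hS gq; lra.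
Qed.

Lemma mdb_in n i h y : (n <= m)%N -> (h <= q)%N -> x h <= y < x h.+1 ->
  N n i y = if covers q d k n i h then
    if n == (m - d h)%N then 1 else C n i y - C n i.+1 y else 0.
Proof.
move=> nm hq hy; rewrite mdbE.
have -> : (y == x q.+1) = false.
  apply/negbTE/eqP.
  have := breakpoint_le_last hS hq; lra.
case: ifPn => [D|/(mdb_defP hS _ nm) D]; last first.
  by rewrite ifF//; apply/negP => c; apply: D; exists h.
apply: mdb_pieceE => //.
  by case/and3P: D.
by case/and3P: D; lia.
Qed.

Lemma mdb_out n i y : ~~ (x 0%N <= y <= x q.+1) -> N n i y = 0.
Proof.
move=> yab; rewrite mdbE; case: ifP => // _.
have -> : (y == x q.+1) = false.
  apply/negbTE/eqP => yb; move: yab; rewrite yb lexx andbT.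
  by rewrite (breakpoint_le hS).
by apply: mdb_piece_out; apply: contra yab => /andP[-> /ltW].
Qed.

Lemma mdb_undef n i y : ~~ mdb_defined q x d k n i -> N n i y = 0.
Proof. by move=> /negbTE nD; rewrite mdbE nD. Qed.

End StructureFormula.

(** * Integrals of linear combinations and of positive functions *)

Section LinearCombination.
Context (disp : measure_display) (T : measurableType disp) (R : realType).
Context (mu : {measure set T -> \bar R}).
Context (D : set T) (mD : measurable D) (c : nat -> R) (F : nat -> T -> R).
Hypothesis iF : forall i, mu.-integrable D (EFin \o F i).

Lemma integrable_scale (a : R) (f : T -> R) : mu.-integrable D (EFin \o f) ->
  mu.-integrable D (EFin \o (fun y => a * f y)).
Proof. exact: integrableZl. Qed.

Lemma integrable_lincomb (r : seq nat) :
  mu.-integrable D (EFin \o (fun y => \sum_(i <- r) c i * F i y)).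
Proof.
elim: r => [|i r IH].
  apply: (eq_integrable mD _ _ _ (integrable0 mu D)).
  by move=> y _; rewrite /= big_nil.
apply: (eq_integrable mD _ _ _
  (integrableD mD (integrable_scale (c i) (iF i)) IH)).
by move=> y _; rewrite /= big_cons.
Qed.

Lemma Rintegral_lincomb (r : seq nat) :
  \int[mu]_(y in D) (\sum_(i <- r) c i * F i y)
  = \sum_(i <- r) c i * \int[mu]_(y in D) F i y.
Proof.
elim: r => [|i r IH].
  under eq_Rintegral do rewrite big_nil.
  by rewrite Rintegral_cst// mul0r big_nil.
under eq_Rintegral do rewrite big_cons.
rewrite RintegralD//; [|exact/integrable_scale|exact: integrable_lincomb].
by rewrite RintegralZl// IH big_cons.
Qed.

End LinearCombination.

(** If the integral were 0, f would vanish almost everywhere on D, and D would be negligible. *)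
Lemma Rintegral_gt0 (disp : measure_display) (T : measurableType disp)
    (R : realType) (mu : {measure set T -> \bar R}) (D : set T) (f : T -> R) :
  measurable D -> mu.-integrable D (EFin \o f) -> mu D != 0%E ->
  (forall y, D y -> 0 < f y) -> 0 < \int[mu]_(y in D) f y.
Proof.
move=> mD fi muD f0; rewrite lt0r Rintegral_ge0 ?andbT; last first.
  by move=> y /f0/ltW.
apply: contra muD => /eqP int0; apply/eqP.
have : (\int[mu]_(y in D) `|(f y)%:E| = 0)%E.
  rewrite -[RHS]/(0%:E) -int0 /Rintegral fineK; last first.
    exact: integrable_fin_num.
  apply: eq_integral => y; rewrite inE => /f0 fy.
  by rewrite abse_EFin ger0_norm// ltW.
move=> /(ae_eq_integral_abs mu mD (measurable_int mu fi)) ae0.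
apply: (measure_negligible mD); apply: negligibleS ae0 => y Dy /(_ Dy) [] fy0.
by have := f0 y Dy; rewrite fy0 ltxx.
Qed.

(** * Sign changes *)

Section SignChanges.
Context {R : realType}.
Local Notation mu := (@lebesgue_measure R).
Implicit Types (f g : R -> R) (D : set R) (l : seq R).

(** Removing one point does not change the integral. The point to avoid will be the right end of
    [a, b], where values are left limits and the recurrence does not apply directly. *)
Lemma Rintegral_gt0_ex g D (b : R) : measurable D ->
  mu.-integrable setT (EFin \o g) -> 0 < \int[mu]_(z in D) g z ->
  exists z, [/\ D z, z != b & 0 < g z].
Proof.
move=> mD ig; rewrite ltNge => /negP H; apply/not_existsP => nz; apply: H.
have iD : mu.-integrable D (EFin \o g) by exact: integrableS ig.
have mDb : measurable (D `\ b) by exact: measurableD.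
have iDb : mu.-integrable (D `\ b) (EFin \o g).
  by apply: integrableS iD => //; exact: subIsetl.
have -> : \int[mu]_(z in D) g z = \int[mu]_(z in D `\ b) g z.
  rewrite /Rintegral integral_setD1//; exact: (measurable_int mu).
rewrite -oppr_ge0 -mulN1r -RintegralZl//.
apply: Rintegral_ge0 => z [Dz zb]; rewrite mulN1r oppr_ge0 leNgt.
by apply/negP => gz; apply: (nz z); split => //; apply/eqP.
Qed.

Lemma Rintegral_sign_ex g D (b a : R) : measurable D ->
  mu.-integrable setT (EFin \o g) -> 0 < a * \int[mu]_(z in D) g z ->
  exists z, [/\ D z, z != b & 0 < a * g z].
Proof.
move=> mD ig; rewrite -RintegralZl//; last exact: integrableS ig.
apply: Rintegral_gt0_ex => //.
exact: integrable_scale.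
Qed.

Lemma Rintegral_itv_sub g (u v : R) : mu.-integrable setT (EFin \o g) ->
  u <= v ->
  \int[mu]_(z in `]-oo, v]) g z - \int[mu]_(z in `]-oo, u]) g z
  = \int[mu]_(z in `]u, v]) g z.
Proof.
move=> ig uv; apply: Rintegral_itvB => //; rewrite ?bnd_simp//.
exact: integrableS ig.
Qed.

Lemma Rintegral_itv_subT g (u : R) : mu.-integrable setT (EFin \o g) ->
  \int[mu]_z g z - \int[mu]_(z in `]-oo, u]) g z
  = \int[mu]_(z in `]u, +oo[) g z.
Proof.
move=> ig; rewrite -set_itvNyy.
by apply: Rintegral_itvB; rewrite ?bnd_simp ?set_itvNyy.
Qed.

(** A list of r points witnesses r - 1 sign changes. The separate nonvanishing condition matters
    only for lists of one point. *)
Definition sign_alternating f l : bool :=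
  sorted (fun u v => (u < v) && (f u * f v < 0)) l
    && all (fun u => f u != 0) l.

Lemma eq_sign_alternating f g l : {in l, f =1 g} ->
  sign_alternating f l = sign_alternating g l.
Proof.
move=> fg; rewrite /sign_alternating; congr (_ && _).
  apply: (eq_in_sorted (P := mem l)) => [u v ul vl /=|]; last exact/allP.
  by rewrite !fg.
by apply: eq_in_all => u ul; rewrite fg.
Qed.

Lemma sign_alternating_split f l v : sign_alternating f l ->
  exists l1 l2, [/\ l = l1 ++ l2, sign_alternating f l1, sign_alternating f l2,
    all (fun u => u < v) l1 & all (fun u => v <= u) l2].
Proof.
elim: l => [|u l IH]; first by exists [::], [::].
rewrite /sign_alternating /= => /andP[pl /andP[fu fl]].
have [vu|uv] := leP v u.
  exists [::], (u :: l); rewrite /= fu fl pl; split => //=.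
  rewrite vu /=; apply/allP => w wl.
  have : path <%R u l by apply: sub_path pl => ? ? /andP[].
  by move=> /(order_path_min lt_trans)/allP/(_ w wl)/ltW; exact: le_trans.
have [|l1 [l2 [lE a1 a2 l1v l2v]]] := IH.
  by rewrite /sign_alternating fl andbT; exact: path_sorted pl.
exists (u :: l1), l2; split => //=; rewrite ?lE ?uv//.
move: a1 pl; rewrite /sign_alternating/= fu lE => /andP[_ ->].
by rewrite cat_path !andbT => /andP[].
Qed.

(** Between consecutive points f changes sign, so g takes somewhere the sign of the later value;
    when r holds, f returns to 0 at infinity and g takes the sign opposite to the last value. The
    clause on [take 1 zs] locates the first new point, so that the induction can put another one
    before it. *)
Lemma sign_alternating_primitive_right g f (c b y : R) (r : bool) l :
  mu.-integrable setT (EFin \o g) ->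
  path (fun u v => (u < v) && (f u * f v < 0)) y l ->
  f y != 0 ->
  (forall u, u \in y :: l -> f u = c + \int[mu]_(z in `]-oo, u]) g z) ->
  (r -> c + \int[mu]_z g z = 0) ->
  exists zs, [/\ size zs = (size l + r)%N, sign_alternating g zs,
    all (predC1 b) zs & all (fun z => (y < z) && (f y * g z < 0)) (take 1 zs)].
Proof.
move=> ig; elim: l y => [|y1 l IH] y /=.
  move=> _ fy0 fE rE; case: r rE => rE; last by exists [::].
  have ry : 0 < - f y * \int[mu]_(z in `]y, +oo[) g z.
    rewrite -Rintegral_itv_subT//.
    have := rE isT; have := fE _ (mem_head _ _); rewrite lt0r => fyE rE'.
    have -> : \int[mu]_z g z - \int[mu]_(z in `]-oo, y]) g z = - f y by lra.
    by rewrite mulf_neq0 ?oppr_eq0//= -expr2 sqr_ge0.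
  have [z [yz zb fz]] := Rintegral_sign_ex b (measurable_itv _) ig ry.
  exists [:: z]; rewrite /sign_alternating /= zb; split => //.
    by rewrite andbT; apply: contraTneq fz => ->; rewrite mulr0 ltxx.
  by move: yz; rewrite /= in_itv/= andbT => ->/=; rewrite andbT; lra.
move=> /andP[/andP[yy1 fyy1] pl] fy0 fE rE.
have fy1 : f y1 != 0 by apply: contraTneq fyy1 => ->; rewrite mulr0 ltxx.
have [|zs [szs azs bzs hzs]] := IH y1 pl fy1 _ rE.
  by move=> u ul; apply: fE; rewrite inE ul orbT.
have ry : 0 < f y1 * \int[mu]_(z in `]y, y1]) g z.
  rewrite -Rintegral_itv_sub//; last exact: ltW.
  have := fE y1; have := fE y; rewrite !inE !eqxx orbT.
  move=> /(_ isT) e /(_ isT) e1.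
  have -> : \int[mu]_(z in `]-oo, y1]) g z - \int[mu]_(z in `]-oo, y]) g z
     = f y1 - f y by lra.
  by rewrite mulrBr; have := sqr_ge0 (f y1); rewrite expr2; nra.
have [z [yz zb fz]] := Rintegral_sign_ex b (measurable_itv _) ig ry.
have gz : g z != 0 by apply: contraTneq fz => ->; rewrite mulr0 ltxx.
move: yz; rewrite /= in_itv/= => /andP[yz zy1].
exists (z :: zs); split => /=.
- by rewrite szs.
- move: azs hzs; rewrite /sign_alternating/= gz.
  case: zs {szs bzs} => //= z1 zs.
  move=> /andP[-> ->]; rewrite take0 andbT /= andbT => /andP[y1z fz1].
  by rewrite (le_lt_trans zy1 y1z)/= andbT; nra.
- by rewrite zb.
- by rewrite take0 yz /= andbT; nra.
Qed.

(** Rolle's theorem for a primitive: one alternation is lost between the points, and one is regained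
    at each end where f vanishes. When p holds, f starts from 0, which gives a point of g before the
    first point of l. *)
Lemma sign_alternating_primitive g f (c b : R) (p r : bool) l :
  mu.-integrable setT (EFin \o g) -> sign_alternating f l -> l != [::] ->
  (forall u, u \in l -> f u = c + \int[mu]_(z in `]-oo, u]) g z) ->
  (p -> c = 0) -> (r -> c + \int[mu]_z g z = 0) ->
  exists zs, [/\ (size zs).+1 = (size l + p + r)%N, sign_alternating g zs
    & all (predC1 b) zs].
Proof.
case: l => // y l ig /andP[/= pl /andP[fy0 _]] _ fE pE rE.
have [zs [szs azs bzs hzs]] :=
  sign_alternating_primitive_right b ig pl fy0 fE rE.
case: p pE => [/(_ isT) c0|_]; last first.
  by exists zs; split => //; rewrite szs /=; lia.
have ry : 0 < f y * \int[mu]_(z in `]-oo, y]) g z.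
  have := fE _ (mem_head _ _); rewrite c0 add0r => <-.
  by rewrite lt0r mulf_neq0//= -expr2 sqr_ge0.
have [z [yz zb fz]] := Rintegral_sign_ex b (measurable_itv _) ig ry.
have gz : g z != 0 by apply: contraTneq fz => ->; rewrite mulr0 ltxx.
exists (z :: zs); split => /=.
- by rewrite szs addn1 !addSn.
- move: yz; rewrite /= in_itv/= => zy.
  move: azs hzs; rewrite /sign_alternating/= gz.
  case: zs {szs bzs} => //= z1 zs.
  move=> /andP[-> ->]; rewrite take0 andbT /= andbT => /andP[y1z fz1].
  by rewrite (le_lt_trans zy y1z)/= andbT; nra.
- by rewrite zb.
Qed.

Lemma Rintegral_itv_gt0 g (u v : R) : mu.-integrable setT (EFin \o g) ->
  u < v -> (forall y, u < y < v -> 0 < g y) ->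
  0 < \int[mu]_(y in `]u, v]) g y.
Proof.
move=> ig uv gp; rewrite -Rintegral_itv_bndo_bndc//; last first.
  exact: integrableS ig.
apply: Rintegral_gt0 => //; first exact: integrableS ig.
by rewrite /= lebesgue_measure_itv/= lte_fin uv -EFinB eqe subr_eq0 gt_eqF.
Qed.

End SignChanges.

(** * The levels of the recurrence *)

Section Levels.
Context {R : realType} (q : nat) (x : nat -> R) (d k : nat -> nat).
Hypothesis hS : mdspline_data q x d k.

Local Notation I h := (mdspline_dim h d k).
Local Notation m := (mdspline_maxdeg q d).
Local Notation s := (left_knot q x d k).
Local Notation t := (right_knot q x d k).
Local Notation T h := (right_count d k h).
Local Notation N := (mdb q x d k).

Local Notation C := (cumul q x d k).
Local Notation mu := (@lebesgue_measure R).
Local Notation b := (x q.+1).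

(* Levels are shifted by one: mdb_shift n i is N_{i,n-1}, so that level 0 is the
   empty one and the recurrence has no special case. *)
Definition mdb_shift (n i : nat) (y : R) : R :=
  if n is n'.+1 then N n' i y else 0.
Definition mdb_shift_defined (n i : nat) : bool :=
  if n is n'.+1 then mdb_defined q x d k n' i else false.
Definition in_support (n i h : nat) : bool :=
  [&& (h <= q)%N, (T h + m.+1 < i + n)%N & (i <= I h)%N].
Local Notation B := mdb_shift.

(** The invariant of the induction on n. In [level_left_end], the condition on g makes x_h the left
    end s_i of the support; just after it, B_{i+1} is negligible with respect to B_i. Sign changes
    are counted away from b only. *)
Record regular_level (n : nat) : Prop := RegularLevel {
  level_measurable : forall i, measurable_fun setT (B n i);
  level_itv01 : forall i y, 0 <= B n i y <= 1;
  level_integral_gt0 : forall i, mdb_shift_defined n i ->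
    0 < \int[mu]_y B n i y;
  level_sign_changes : forall (c : nat -> R) (p r : nat) (l : seq R),
    (0 < p)%N ->
    sign_alternating (fun y => \sum_(p <= i < p + r) c i * B n i y) l ->
    all (predC1 b) l -> (size l <= r)%N;
  level_left_end : forall i h, in_support n i h ->
    (forall g, (g < h)%N -> (I g < i)%N) -> forall e, 0 < e ->
    exists2 eta, 0 < eta & forall y, x h < y < x h + eta ->
      0 < B n i y /\ B n i.+1 y <= e * B n i y }.

Lemma mdb_shift_definedP n i : (n <= m.+1)%N ->
  reflect (exists h, in_support n i h) (mdb_shift_defined n i).
Proof.
case: n => [|n] nm /=.
  apply: ReflectF => -[h /and3P[hq h1 h2]]; have := maxdeg_ge d hq.
  by move: h2; rewrite (left_rightE hS)//; lia.
apply: (iffP (mdb_defP hS _ nm)) => -[h H]; exists h; move: H;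
  by rewrite /covers /in_support !addnS ltnS.
Qed.

Lemma in_support_gt0 n i h : (n <= m.+1)%N -> in_support n i h -> (0 < i)%N.
Proof. by move=> nm /and3P[_ iT _]; move: nm iT; clear; lia. Qed.

Lemma mdb_shift_0 n y : (n <= m.+1)%N -> B n 0%N y = 0.
Proof.
case: n => //= n nm; rewrite mdbE ifF// /mdb_defined add0n.
by rewrite ltnNge -ltnS nm.
Qed.

Lemma mdb_shift_unsupported n i h y : (n <= m.+1)%N ->
  x h <= y < x h.+1 -> (h <= q)%N ->
  ~~ in_support n i h -> B n i y = 0.
Proof.
case: n => //= n nm hy hq; rewrite (mdb_in hS i nm hq hy) => ns.
by rewrite ifF//; apply: negbTE; move: ns; rewrite /in_support !addnS ltnS.
Qed.

Lemma mdb_shift_out n i y : ~~ (x 0%N <= y <= b) -> B n i y = 0.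
Proof. by case: n => //= n; apply: mdb_out. Qed.

(** Level 0 has no defined function, so the step functions at n = 0 obey the same formula as the
    other levels. *)
Lemma cumulE n i y : C n i y =
  mdb_cumul (mdb_shift_defined n i) (s i) (B n i) y.
Proof. by case: n. Qed.

Lemma mdb_shift_integrable n i D : measurable_fun setT (B n i) ->
  (forall y, 0 <= B n i y <= 1) -> measurable D ->
  mu.-integrable D (EFin \o B n i).
Proof.
move=> mB B01 mD; apply: (@integrableS _ _ _ _ setT) => //.
rewrite (_ : EFin \o B n i = (EFin \o B n i) \_ `[x 0%N, b]); last first.
  apply/funext => y; rewrite patchE; case: ifPn => //.
  by rewrite notin_setE/= in_itv/= => /negP yab; rewrite /= mdb_shift_out.
apply/integrable_restrict => //; rewrite setTI.
apply: measurable_bounded_integrable => //.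
- by rewrite /= lebesgue_measure_itv/=; case: ifP; rewrite // -EFinB ltry.
- exact: measurable_funS mB.
- exists 1; split => // M M1 y _ /=; case/andP: (B01 y) => y0 y1.
  by rewrite ger0_norm// (le_trans y1)// ltW.
Qed.

Section Step.
Variable n : nat.
Hypothesis nm : (n <= m)%N.
Hypothesis Ln : regular_level n.
Let nm1 : (n <= m.+1)%N := leqW nm.

Lemma level_ge0 i y : 0 <= B n i y.
Proof. by case/andP: (level_itv01 Ln i y). Qed.

Lemma integrable_level i D : measurable D -> mu.-integrable D (EFin \o B n i).
Proof.
apply: mdb_shift_integrable => [|y]; first exact: level_measurable.
exact: level_itv01.
Qed.

Lemma cumul_defined i y : mdb_shift_defined n i ->
  C n i y = (\int[mu]_z B n i z)^-1 * \int[mu]_(z in `]-oo, y]) B n i z.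
Proof.
move=> Di; rewrite cumulE Di /mdb_cumul RintegralZl//.
exact: integrable_level.
Qed.

Lemma cumul_undefined i h y : (h <= q)%N -> (0 < i)%N -> x h <= y < x h.+1 ->
  ~~ mdb_shift_defined n i -> C n i y = (i <= I h)%:R.
Proof.
move=> hq i0 hy nD; rewrite cumulE (negbTE nD) /mdb_cumul.
by rewrite (left_knot_step hS hq i0 hy).
Qed.

(** Here y < x_{h+1} <= s_i: the primitive has not started to grow. *)
Lemma cumul_left i h y : (h <= q)%N -> (I h < i)%N -> x h <= y < x h.+1 ->
  C n i y = 0.
Proof.
move=> hq iI hy; have i0 : (0 < i)%N by lia.
have [Di|nD] := boolP (mdb_shift_defined n i); last first.
  by rewrite (cumul_undefined hq i0 hy nD) leqNgt iI.
rewrite cumul_defined// (_ : \int[mu]_(z in `]-oo, y]) _ = 0) ?mulr0//.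
rewrite (@eq_Rintegral _ _ _ _ _ (fun=> 0)) ?Rintegral_cst ?mul0r//.
move=> z; rewrite inE/= in_itv/= => zy.
have [az|za] := leP (x 0%N) z; last first.
  by apply: mdb_shift_out; rewrite negb_and -ltNge za.
have zb : z < b.
  have := breakpoint_le_last hS hq; lra.
have [|g gq gz] := @breakpoint_interval _ q x z; first by rewrite az.
rewrite (mdb_shift_unsupported nm1 gz gq)// /in_support gq /= negb_and -!ltnNge.
apply/orP; right; apply: leq_ltn_trans iI; apply: left_count_le.
rewrite leqNgt; apply/negP => hg.
have := @breakpoint_le _ _ _ _ _ hS h.+1 g hg (leqW gq); lra.
Qed.

(** The support ends at x_h or before, so the whole normalised mass lies to the left of y; an
    undefined function has its step at s_i <= x_h. *)
Lemma cumul_right i h y : (h <= q)%N -> (0 < i <= I h)%N ->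
  (i + n <= T h + m.+1)%N -> x h <= y < x h.+1 -> C n i y = 1.
Proof.
move=> hq /andP[i0 iI] iT hy.
have [Di|nD] := boolP (mdb_shift_defined n i); last first.
  by rewrite (cumul_undefined hq i0 hy nD) iI.
rewrite cumul_defined//.
have /eqP := @Rintegral_itv_subT _ _ y (@integrable_level i _ measurableT).
rewrite (_ : \int[mu]_(z in `]y, +oo[) _ = 0).
  by rewrite subr_eq0 => /eqP <-; rewrite mulVf// gt_eqF// level_integral_gt0.
apply/eqP; rewrite eq_le Rintegral_ge0 ?andbT; last first.
  by move=> z _; apply: level_ge0.
rewrite leNgt; apply/negP => ig.
(* A point other than b at which the function is nonzero lies in some breakpoint interval, where the
   support criterion applies. *)
have [z [yz zb Bz]] := Rintegral_gt0_ex b (measurable_itv _)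
  (@integrable_level i _ measurableT) ig.
move: yz; rewrite /= in_itv/= andbT => yz.
have az : x 0%N <= z by have := breakpoint_le hS (leq0n h) (leqW hq); lra.
have {}zb : z < b.
  rewrite lt_neqAle zb leNgt; apply/negP => bz.
  by move: Bz; rewrite mdb_shift_out ?ltxx// negb_and -!ltNge bz orbT.
have [|g gq gz] := @breakpoint_interval _ q x z; first by rewrite az.
move: Bz; rewrite (mdb_shift_unsupported nm1 gz gq) ?ltxx//.
have hg : (h <= g)%N.
  rewrite leqNgt; apply/negP => gh.
  have := @breakpoint_le _ _ _ _ _ hS g.+1 h gh (leqW hq); lra.
rewrite /in_support gq /= negb_and -leqNgt; apply/orP; left.
by apply: leq_trans iT _; rewrite leq_add2r right_count_le.
Qed.

Lemma cumul_nondecreasing i : nondecreasing_fun (C n i).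
Proof.
move=> u v uv.
have [Di|nD] := boolP (mdb_shift_defined n i); last first.
  rewrite !cumulE (negbTE nD) /mdb_cumul ler_nat.
  by case: (leP (s i) u) => // su; rewrite (le_trans su).
rewrite !cumul_defined// ler_wpM2l//.
  by rewrite invr_ge0 ltW// level_integral_gt0.
rewrite -subr_ge0 Rintegral_itv_sub//; last exact: integrable_level.
by apply: Rintegral_ge0 => z _; apply: level_ge0.
Qed.

Lemma cumul_itv01 i y : 0 <= C n i y <= 1.
Proof.
have [Di|nD] := boolP (mdb_shift_defined n i); last first.
  rewrite !cumulE (negbTE nD) /mdb_cumul.
  by case: (s i <= y)%R; rewrite /= ?lexx ?ler01.
have ip := level_integral_gt0 Ln Di.
rewrite cumul_defined// mulr_ge0//=.
- rewrite mulrC ler_pdivrMr// mul1r -subr_ge0 Rintegral_itv_subT//.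
    by apply: Rintegral_ge0 => z _; apply: level_ge0.
  exact: integrable_level.
- by rewrite invr_ge0 ltW.
- by apply: Rintegral_ge0 => z _; apply: level_ge0.
Qed.

(** The cases of the recurrence merge. Where the value is prescribed to be 1, the difference is 1 -
    0; off the support, both terms are 0 or both are 1. *)
Lemma next_level_in i h y : (h <= q)%N -> (0 < i)%N -> x h <= y < x h.+1 ->
  B n.+1 i y = if (m <= d h + n)%N then C n i y - C n i.+1 y else 0.
Proof.
move=> hq i0 hy; rewrite /= (mdb_in hS i nm hq hy).
have := maxdeg_ge d hq; have := left_rightE hS hq => IT dm.
have [/and3P[_ iT iI]|nc] := boolP (covers q d k n i h).
  have mdn : (m <= d h + n)%N by lia.
  rewrite mdn.
  case: eqVneq => // nd.
  rewrite (cumul_right hq _ _ hy) ?i0//; last by lia.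
  by rewrite (cumul_left hq _ hy) ?subr0//; lia.
case: ifP => // mdn; move: nc; rewrite /covers hq /= negb_and -leqNgt -ltnNge.
have [iI _|iI] := ltnP (I h) i.
  by rewrite !(cumul_left hq _ hy) ?subrr//; lia.
rewrite orbF => iT; rewrite !(cumul_right hq _ _ hy) ?subrr ?i0//; lia.
Qed.

(** A function of smaller index alive on this interval would make i supported there at level n. With
    the next lemma, an undefined index i decouples the next level at s_i: smaller indices live to
    its left, the others to its right. *)
Lemma next_level_right i j h y : (0 < i)%N -> (h <= q)%N ->
  ~~ mdb_shift_defined n i ->
  x h <= y < x h.+1 -> (i <= I h)%N -> (j < i)%N -> B n.+1 j y = 0.
Proof.
move=> i0 hq nD hy iI ji; apply: (@mdb_shift_unsupported _ _ _ _ _ hy) => //.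
apply: contra nD => /and3P[_ jT _]; apply/mdb_shift_definedP => //.
by exists h; rewrite /in_support hq iI andbT/=; lia.
Qed.

Lemma next_level_left j h y : (h <= q)%N ->
  x h <= y < x h.+1 -> (I h < j)%N -> B n.+1 j y = 0.
Proof.
move=> hq hy ji; apply: (@mdb_shift_unsupported _ _ _ _ _ hy) => //.
by rewrite /in_support hq /= negb_and -!ltnNge ji orbT.
Qed.

End Step.
End Levels.

(** * Sign changes pass to the next level *)

Section SignChangesNextLevel.
Context {R : realType} (q : nat) (x : nat -> R) (d k : nat -> nat).
Hypothesis hS : mdspline_data q x d k.

Local Notation I h := (mdspline_dim h d k).
Local Notation m := (mdspline_maxdeg q d).
Local Notation s := (left_knot q x d k).
Local Notation t := (right_knot q x d k).
Local Notation T h := (right_count d k h).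
Local Notation N := (mdb q x d k).

Local Notation C := (cumul q x d k).
Local Notation mu := (@lebesgue_measure R).
Local Notation b := (x q.+1).

Local Notation B := (mdb_shift q x d k).
Local Notation Bdef := (mdb_shift_defined q x d k).
Local Notation regular := (regular_level q x d k).

(** Summation by parts with c extended by 0 outside the range: r differences give r + 1 terms. *)
Lemma abel_sum (c z : nat -> R) p r :
  \sum_(p <= i < p + r) c i * (z i - z i.+1) =
  \sum_(p <= i < (p + r).+1)
    ((if (i < p + r)%N then c i else 0) - (if (p < i)%N then c i.-1 else 0))
      * z i.
Proof.
under eq_bigr do rewrite mulrBr.
under [RHS]eq_bigr do rewrite mulrBl.
rewrite !sumrB; congr (_ - _).
  rewrite [RHS]big_nat_recr ?leq_addr//= ltnn mul0r addr0.
  by apply: eq_big_nat => i /andP[_ ->].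
rewrite [RHS]big_ltn ?ltnS ?leq_addr// ltnn mul0r add0r big_add1.
by apply: eq_big_nat => i /andP[pi _]; rewrite ltnS pi.
Qed.

Section Step.
Variable n : nat.
Hypothesis nm : (n <= m)%N.
Hypothesis Ln : regular n.

Lemma mdb_shift_undefined i y : ~~ Bdef n i -> B n i y = 0.
Proof. by case: n => //= n'; apply: mdb_undef. Qed.

Lemma combination_interval (c : nat -> R) p r y : y != b ->
  \sum_(p <= i < p + r) c i * B n.+1 i y != 0 ->
  exists2 h, (h <= q)%N & x h <= y < x h.+1.
Proof.
move=> yb f0; apply: breakpoint_interval; apply: contraNT f0 => yab.
rewrite big1// => i _; rewrite (mdb_shift_out hS) ?mulr0//.
by apply: contra yab; rewrite lt_neqAle yb.
Qed.

(* Rolle's theorem, in integral form: when all the intermediate functions of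
   level n are defined, the combination is a constant plus the primitive of a
   combination of the functions of level n with at most one more term, and
   it vanishes at each end where the extreme function is defined. *)
Lemma sign_changes_connected (c : nat -> R) (p r : nat) (l : seq R) :
  (0 < p)%N -> (0 < r)%N ->
  (forall i, (p < i < p + r)%N -> Bdef n i) ->
  sign_alternating (fun y => \sum_(p <= i < p + r) c i * B n.+1 i y) l ->
  all (predC1 b) l -> (size l <= r)%N.
Proof.
move=> p0 r0 mid; set f := (fun y => _) => altl lb.
have [->//|l0] := eqVneq l [::].
pose w i := (\int[mu]_y B n i y)^-1.
pose c' i := (if (i < p + r)%N then c i else 0)
  - (if (p < i)%N then c i.-1 else 0).
pose G i y := w i * B n i y.
pose g y := \sum_(p <= i < (p + r).+1) c' i * G i y.
have iG i : mu.-integrable setT (EFin \o G i).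
  by apply: integrable_scale => //; exact: integrable_level.
have ig : mu.-integrable setT (EFin \o g) by exact: integrable_lincomb.
have intg D : measurable D -> \int[mu]_(y in D) g y =
    \sum_(p <= i < p + r) c i * (w i * \int[mu]_(y in D) B n i y
      - w i.+1 * \int[mu]_(y in D) B n i.+1 y).
  move=> mD; rewrite Rintegral_lincomb//; last first.
    by move=> i; exact: integrableS (iG i).
  rewrite (abel_sum _ (fun i => w i * \int[mu]_(y in D) B n i y)).
  by apply: eq_bigr => i _; rewrite RintegralZl//; exact: integrable_level.
have wB i : w i * \int[mu]_y B n i y = (Bdef n i)%:R.
  have [Di|nD] := boolP (Bdef n i).
    by rewrite mulVf// gt_eqF// (level_integral_gt0 Ln).
  rewrite (@eq_Rintegral _ _ _ _ _ (fun=> 0)) ?Rintegral_cst ?mul0r ?mulr0//.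
  by move=> z _; rewrite mdb_shift_undefined.
have rE : r = r.-1.+1 by rewrite prednK.
(* If the function at p is undefined, its step function is 1 wherever the combination is nonzero,
   hence a constant term. *)
pose kappa := c p * (~~ Bdef n p)%:R.
have fE u : u \in l -> f u = kappa + \int[mu]_(z in `]-oo, u]) g z.
  move=> ul; have fu : f u != 0 by case/andP: altl => _ /allP; apply.
  have ub : u != b by have /allP := lb; apply.
  have [h hq hu] := combination_interval ub fu.
  have dh : (m <= d h + n)%N.
    apply: contraNT fu => /negbTE dh.
    rewrite /f big_nat big1// => i /andP[pi _].
    by rewrite (next_level_in hS nm Ln hq (leq_trans p0 pi) hu) dh mulr0.
  have pI : (p <= I h)%N.
    apply: contraNT fu; rewrite -ltnNge /f => Ip.
    rewrite big_nat big1// => i /andP[pi _].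
    by rewrite (next_level_left hS nm hq hu (leq_trans Ip pi)) mulr0.
  (* If the function at p + r is undefined, the combination vanishes to the right of s_{p+r}, so its
     step function is 0 at u. *)
  have rI : ~~ Bdef n (p + r) -> (I h < p + r)%N.
    move=> nD; rewrite ltnNge; apply: contra fu => rI; apply/eqP.
    rewrite /f big_nat big1// => i /andP[_ ir].
    by rewrite (next_level_right hS nm _ hq nD hu rI ir) ?mulr0// addn_gt0 p0.
  have Cw i : (p <= i <= p + r)%N -> C n i u =
      (i == p)%:R * (~~ Bdef n p)%:R
      + w i * \int[mu]_(z in `]-oo, u]) B n i z.
    move=> /andP[pi ir].
    have [Di|nD] := boolP (Bdef n i).
      rewrite (cumul_defined hS Ln)//; case: eqVneq Di => [->->|_ _] /=;
      by rewrite ?mulr0 ?mul0r add0r.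
    rewrite (@eq_Rintegral _ _ _ _ _ (fun=> 0)); last first.
      by move=> z _; rewrite mdb_shift_undefined.
    rewrite Rintegral_cst// mul0r mulr0 addr0.
    rewrite (cumul_undefined hS hq (leq_trans p0 pi) hu nD).
    case: (eqVneq i p) nD => [-> ->|ip nD]; first by rewrite pI mulr1.
    rewrite mul0r; have [ir'|ri] := ltnP i (p + r).
      by move: nD; rewrite mid// ltn_neqAle eq_sym ip pi.
    have ipr : i = (p + r)%N by apply/eqP; rewrite eqn_leq ir ri.
    by rewrite leqNgt ipr rI// -ipr.
  rewrite intg//.
  transitivity (\sum_(p <= i < p + r) (c i * ((i == p)%:R * (~~ Bdef n p)%:R)
    + c i * (w i * \int[mu]_(y in `]-oo, u]) B n i y
      - w i.+1 * \int[mu]_(y in `]-oo, u]) B n i.+1 y))).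
    rewrite /f; apply: eq_big_nat => i /andP[pi ir].
    rewrite (next_level_in hS nm Ln hq (leq_trans p0 pi) hu) dh.
    rewrite !Cw ?pi ?ir ?(leqW pi) ?(ltnW ir)//.
    by rewrite (@gtn_eqF p i.+1) ?ltnS// mul0r add0r -mulrDr addrA.
  rewrite big_split/=; congr (_ + _).
  rewrite big_ltn; last by rewrite -addn1 leq_add2l.
  rewrite eqxx mul1r big_nat big1 ?addr0// => i /andP[pi _].
  by rewrite gtn_eqF// mul0r mulr0.
have kp : Bdef n p -> kappa = 0 by rewrite /kappa => ->; rewrite mulr0.
(* All normalised masses after p are 1, so only the term at p remains: it is 0 if the function at p
   is defined and - c p otherwise. *)
have kr : Bdef n (p + r) -> kappa + \int[mu]_z g z = 0.
  move=> Dr; rewrite intg//; under eq_bigr do rewrite !wB.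
  have Dmid i : (p < i <= p + r)%N -> Bdef n i.
    move=> /andP[pi]; rewrite leq_eqVlt => /orP[/eqP->//|ir].
    by apply: mid; rewrite pi.
  rewrite big_ltn; last by rewrite -addn1 leq_add2l.
  rewrite big_nat big1 => [|i /andP[pi ir]]; last first.
    by rewrite !Dmid ?subrr ?mulr0// ?ir ?pi ?(ltnW ir) ?(leqW pi).
  rewrite addr0 (Dmid p.+1); last by rewrite ltnSn -addn1 leq_add2l.
  by rewrite /kappa; case: (Bdef n p); rewrite /= ?mulr1 ?mulr0; ring.
have [zs [szs altz zb]] := sign_alternating_primitive b ig altl l0 fE kp kr.
(* Undefined extreme functions are zero and are dropped, which leaves r' terms from p' on. The gains
   at the ends in Rolle's theorem match the terms kept, so the bound r' on [zs] gives the bound r on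
   [l]. *)
pose p' := (p + ~~ Bdef n p)%N.
pose r' := (r.-1 + Bdef n p + Bdef n (p + r))%N.
suff : (size zs <= r')%N by rewrite /r'; lia.
apply: (level_sign_changes Ln (c := fun i => c' i * w i) (p := p')) zb.
  by rewrite /p'; lia.
congr (is_true (sign_alternating _ _)) : altz.
apply/funext => y; rewrite /g.
under eq_bigr do rewrite /G mulrA.
have -> : \sum_(p <= i < (p + r).+1) c' i * w i * B n i y
    = \sum_(p' <= i < (p + r).+1) c' i * w i * B n i y.
  rewrite /p'; case: (boolP (Bdef n p)) => [_|nD]; first by rewrite addn0.
  by rewrite big_ltn ?mdb_shift_undefined ?mulr0 ?add0r ?addn1// ltnS leq_addr.
have [Dr|nD] := boolP (Bdef n (p + r)).
  congr (\sum_(_ <= _ < _) _); rewrite /p' /r' Dr; case: (Bdef n p) => /=; lia.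
rewrite big_nat_recr/=; last by rewrite /p'; case: (Bdef n p) => /=; lia.
rewrite mdb_shift_undefined// mulr0 addr0.
congr (\sum_(_ <= _ < _) _); rewrite /p' /r' (negbTE nD).
by case: (Bdef n p) => /=; lia.
Qed.

(** Strong induction on r. At an undefined index j = p + i inside the range, the points are cut at
    s_j: those before it see only the i terms below j, the others only the remaining r - i, and the
    two bounds add up. *)
Lemma next_level_sign_changes (c : nat -> R) (p r : nat) (l : seq R) :
  (0 < p)%N ->
  sign_alternating (fun y => \sum_(p <= i < p + r) c i * B n.+1 i y) l ->
  all (predC1 b) l -> (size l <= r)%N.
Proof.
elim/ltn_ind: r p l => r IH p l p0 altl lb.
have [r0|r0] := posnP r.
  move: altl; rewrite r0 addn0; case: l {lb} => //= u l.
  by rewrite /sign_alternating/= big_geq// eqxx andbF.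
have [/existsP[i /andP[i0 nD]]|/existsPn mid] := boolP
    [exists i : 'I_r, (0 < i)%N && ~~ Bdef n (p + i)]; last first.
  apply: (sign_changes_connected p0 r0 _ altl lb) => i /andP[pi ir].
  have ir' : (i - p < r)%N by lia.
  have := mid (Ordinal ir'); rewrite /= subnKC ?(ltnW pi)// negb_and negbK.
  by rewrite -leqNgt leqn0 subn_eq0 leqNgt pi.
have ir := ltn_ord i; set j := (p + i)%N in nD.
have [l1 [l2 [lE alt1 alt2 l1s l2s]]] := sign_alternating_split (s j) altl.
rewrite lE size_cat -(subnKC (ltnW ir)).
have lint u : u \in l -> exists2 h, (h <= q)%N & x h <= u < x h.+1.
  move=> ul; apply: combination_interval (allP lb u ul) _.
  by case/andP: altl => _ /allP; exact.
have fE u : \sum_(p <= a < p + r) c a * B n.+1 a u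
    = \sum_(p <= a < j) c a * B n.+1 a u
      + \sum_(j <= a < j + (r - i)) c a * B n.+1 a u.
  rewrite -big_cat_nat//=; rewrite /j; [|lia..].
  by congr (\sum_(_ <= _ < _) _); lia.
have j0 : (0 < j)%N by rewrite /j; lia.
move: lb lint; rewrite lE all_cat => /andP[lb1 lb2] lint.
apply: leq_add.
  apply: (IH i ir p) => //; move: alt1; rewrite (@eq_sign_alternating _ _
    (fun y => \sum_(p <= a < j) c a * B n.+1 a y))// => u ul /=.
  rewrite fE [X in _ + X]big_nat [X in _ + X]big1 ?addr0// => a /andP[ja _].
  have [|h hq hu] := lint u; first by rewrite mem_cat ul.
  have := allP l1s u ul.
  rewrite ltNge (left_knot_step hS hq j0 hu) -ltnNge => Ij.
  by rewrite (next_level_left hS nm hq hu (leq_trans Ij ja)) mulr0.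
apply: (IH (r - i)%N _ j) => //; first by lia.
move: alt2; rewrite (@eq_sign_alternating _ _
  (fun y => \sum_(j <= a < j + (r - i)) c a * B n.+1 a y))// => u ul /=.
rewrite fE [X in X + _]big_nat [X in X + _]big1 ?add0r// => a /andP[_ aj].
have [|h hq hu] := lint u; first by rewrite mem_cat ul orbT.
have := allP l2s u ul; rewrite (left_knot_step hS hq j0 hu) => Ij.
by rewrite (next_level_right hS nm j0 hq nD hu Ij aj) mulr0.
Qed.
End Step.
End SignChangesNextLevel.

(** * Cumulative functions at the left end of the support *)

Section LeftEndCumulative.
Context {R : realType} (q : nat) (x : nat -> R) (d k : nat -> nat).
Hypothesis hS : mdspline_data q x d k.

Local Notation I h := (mdspline_dim h d k).
Local Notation m := (mdspline_maxdeg q d).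
Local Notation s := (left_knot q x d k).
Local Notation t := (right_knot q x d k).
Local Notation T h := (right_count d k h).
Local Notation N := (mdb q x d k).

Local Notation C := (cumul q x d k).
Local Notation mu := (@lebesgue_measure R).
Local Notation b := (x q.+1).

Local Notation B := (mdb_shift q x d k).
Local Notation Bdef := (mdb_shift_defined q x d k).
Local Notation regular := (regular_level q x d k).
Local Notation supp := (in_support q d k).

Section Step.
Variable n : nat.
Hypothesis nm : (n <= m)%N.
Hypothesis Ln : regular n.
Let nm1 : (n <= m.+1)%N := leqW nm.

Lemma integral_from_left_end i h y : (h <= q)%N ->
  (forall g, (g < h)%N -> (I g < i)%N) -> x h <= y ->
  \int[mu]_(z in `]-oo, y]) B n i z = \int[mu]_(z in `]x h, y]) B n i z.
Proof.
move=> hq hmin hy.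
rewrite -(Rintegral_itv_sub (integrable_level hS Ln i measurableT) hy).
rewrite -[X in _ - X]Rintegral_itv_bndo_bndc; last exact: integrable_level.
rewrite [X in _ - X](@eq_Rintegral _ _ _ _ _ (fun=> 0)).
  by rewrite Rintegral_cst// mul0r subr0.
move=> z; rewrite inE/= in_itv/= => zh.
have [az|za] := leP (x 0%N) z; last first.
  by apply: (mdb_shift_out hS); rewrite negb_and -ltNge za.
have hb := breakpoint_le hS (leqW hq) (leqnn _).
have [|g gq gz] := @breakpoint_interval _ q x z.
  by rewrite az (lt_le_trans zh).
rewrite (mdb_shift_unsupported hS nm1 gz gq)// /in_support gq /= negb_and.
rewrite -!ltnNge hmin ?orbT//.
rewrite ltnNge; apply/negP => hg.
have := breakpoint_le hS hg (leqW gq); case/andP: gz; lra.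
Qed.

(** On the interval h, C_i is either already 1 or the primitive of a function positive near x_h;
    C_{i+1} is either 0 or a primitive starting at x_h. The comparison of the integrands at level n
    is then integrated. *)
Lemma cumul_left_end i h e : supp n.+1 i h ->
  (forall g, (g < h)%N -> (I g < i)%N) -> 0 < e ->
  exists2 eta, 0 < eta <= x h.+1 - x h & forall y, x h < y < x h + eta ->
    0 < C n i y /\ C n i.+1 y <= e * C n i y.
Proof.
move=> /and3P[hq iT iI] hmin e0.
have eta0 : 0 < x h.+1 - x h by rewrite subr_gt0 (breakpoint_lt hS).
have hmin' g : (g < h)%N -> (I g < i.+1)%N by move=> /hmin/ltnW.
have hin eta y : eta <= x h.+1 - x h -> x h < y < x h + eta ->
    x h <= y < x h.+1 by lra.
have Cpos i' y : Bdef n i' -> (forall g, (g < h)%N -> (I g < i')%N) ->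
    x h <= y -> C n i' y = (\int[mu]_z B n i' z)^-1 *
      \int[mu]_(z in `]x h, y]) B n i' z.
  move=> Di hm hy; rewrite (cumul_defined hS Ln)//.
  by rewrite (integral_from_left_end hq hm hy).
have [iT'|iT'] := ltnP (T h + m.+1) (i + n); last first.
  have i0 : (0 < i)%N by lia.
  have C1 eta y : eta <= x h.+1 - x h -> x h < y < x h + eta -> C n i y = 1.
    move=> etah hy; apply: (cumul_right hS nm Ln hq _ iT' (hin _ _ etah hy)).
    by rewrite i0.
  have [iI'|iI'] := ltnP (I h) i.+1.
    exists (x h.+1 - x h); first by rewrite eta0 lexx.
    move=> y hy; rewrite (C1 _ _ (lexx _) hy) ltr01 mulr1; split => //.
    by rewrite (cumul_left hS nm Ln hq iI' (hin _ _ (lexx _) hy)) ltW.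
  have D1 : Bdef n i.+1.
    by apply/(mdb_shift_definedP hS _ nm1); exists h;
    rewrite /in_support hq iI' andbT /=; move: iT; clear; lia.
  have w0 := level_integral_gt0 Ln D1.
  set w := \int[mu]_z _ in w0.
  (* Since the integrand is at most 1, C_{i+1}(y) <= (y - x_h) / w, which is at most e for y < x_h +
     e w. *)
  exists (Num.min (x h.+1 - x h) (e * w)).
    by rewrite lt_min eta0 mulr_gt0//= ge_min lexx.
  move=> y; rewrite -ltrBlDl lt_min => /andP[hy /andP[yh yw]].
  have hy' : x h < y < x h + (x h.+1 - x h) by rewrite hy -ltrBlDl.
  rewrite (C1 _ _ (lexx _) hy') ltr01 mulr1; split => //.
  rewrite (Cpos _ _ D1 hmin' (ltW hy)) -/w mulrC ler_pdivrMr//.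
  apply: le_trans (ltW yw).
  apply: (@le_trans _ _ (\int[mu]_(z in `]x h, y]) 1)).
    apply: le_Rintegral => //.
    - exact: integrable_level.
    - apply: measurable_bounded_integrable => //.
        by rewrite /= lebesgue_measure_itv/= lte_fin hy -EFinB ltry.
      exists 1; split => // M M1 z _ /=.
      by rewrite normr1 ltW.
    - by move=> z _; case/andP: (level_itv01 Ln i.+1 z).
  by rewrite Rintegral_cst//= lebesgue_measure_itv/= lte_fin hy /= mul1r.
have D0 : Bdef n i.
  apply/(mdb_shift_definedP hS _ nm1).
  by exists h; rewrite /in_support hq iI iT'.
have w0 := level_integral_gt0 Ln D0.
have s0 : supp n i h by rewrite /in_support hq iI iT'.
have [iI'|iI'] := ltnP (I h) i.+1.
  have [eta et0 etaP] := level_left_end Ln s0 hmin ltr01.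
  exists (Num.min (x h.+1 - x h) eta).
    by rewrite lt_min eta0 et0 ge_min lexx.
  move=> y; rewrite -ltrBlDl lt_min => /andP[hy /andP[yh yw]].
  have Cy : 0 < C n i y.
    rewrite (Cpos _ _ D0 hmin (ltW hy)) mulr_gt0// ?invr_gt0//.
    apply: Rintegral_itv_gt0 => //; first exact: integrable_level.
    by move=> z hz; apply: (etaP z _).1; lra.
  split => //; rewrite (cumul_left hS nm Ln hq iI').
    by rewrite mulr_ge0// ltW.
  by apply: (hin (x h.+1 - x h)) => //; lra.
have D1 : Bdef n i.+1.
  by apply/(mdb_shift_definedP hS _ nm1); exists h;
    rewrite /in_support hq iI' andbT /=; move: iT; clear; lia.
have w1 := level_integral_gt0 Ln D1.
set w := \int[mu]_z _ in w0; set w' := \int[mu]_z _ in w1.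
(* The factor w' / w compensates the different normalisations of C_i and C_{i+1}. *)
have e'0 : 0 < e * (w' / w) by rewrite mulr_gt0// divr_gt0.
have [eta et0 etaP] := level_left_end Ln s0 hmin e'0.
exists (Num.min (x h.+1 - x h) eta).
  by rewrite lt_min eta0 et0 ge_min lexx.
move=> y; rewrite -ltrBlDl lt_min => /andP[hy /andP[yh yw]].
rewrite (Cpos _ _ D0 hmin (ltW hy)) (Cpos _ _ D1 hmin' (ltW hy)); split.
  rewrite mulr_gt0// ?invr_gt0//.
  apply: Rintegral_itv_gt0 => //; first exact: integrable_level.
  by move=> z hz; apply: (etaP z _).1; lra.
rewrite -/w -/w' mulrC ler_pdivrMr//.
rewrite [leRHS](_ : _ =
  e * (w' / w) * \int[mu]_(z in `]x h, y]) B n i z); last by ring.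
rewrite -RintegralZl//; last exact: integrable_level.
apply: le_Rintegral => //.
- exact: integrable_level.
- by apply: integrable_scale => //; exact: integrable_level.
- move=> z; rewrite /= in_itv/= => zy.
  by apply: (etaP z _).2; lra.
Qed.

End Step.
End LeftEndCumulative.

(** * Regularity of the next level *)

Section NextLevel.
Context {R : realType} (q : nat) (x : nat -> R) (d k : nat -> nat).
Hypothesis hS : mdspline_data q x d k.

Local Notation I h := (mdspline_dim h d k).
Local Notation m := (mdspline_maxdeg q d).
Local Notation s := (left_knot q x d k).
Local Notation t := (right_knot q x d k).
Local Notation T h := (right_count d k h).
Local Notation N := (mdb q x d k).

Local Notation C := (cumul q x d k).
Local Notation mu := (@lebesgue_measure R).
Local Notation b := (x q.+1).

Local Notation B := (mdb_shift q x d k).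
Local Notation Bdef := (mdb_shift_defined q x d k).
Local Notation regular := (regular_level q x d k).
Local Notation supp := (in_support q d k).

Section Step.
Variable n : nat.
Hypothesis nm : (n <= m)%N.
Hypothesis Ln : regular n.


Lemma next_level_left_end i h e : supp n.+1 i h ->
  (forall g, (g < h)%N -> (I g < i)%N) -> 0 < e ->
  exists2 eta, 0 < eta <= x h.+1 - x h & forall y, x h < y < x h + eta ->
    0 < B n.+1 i y /\ C n i.+1 y <= e * B n.+1 i y.
Proof.
move=> si hmin e0; have /and3P[hq iT iI] := si.
(* C_{i+1} <= e / (1 + e) C_i is equivalent to C_{i+1} <= e (C_i - C_{i+1}). *)
have e1 : 0 < e / (1 + e) by rewrite divr_gt0//; lra.
have [eta etah etaP] := cumul_left_end hS nm Ln si hmin e1.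
exists eta => // y hy; have [Cp Ce] := etaP y hy.
have hin : x h <= y < x h.+1 by lra.
have i0 : (0 < i)%N := in_support_gt0 (nm : (n.+1 <= m.+1)%N) si.
have IT := left_rightE hS hq.
rewrite (next_level_in hS nm Ln hq i0 hin) ifT; last first.
  by move: iT iI IT; clear; lia.
have {}Ce : (1 + e) * C n i.+1 y <= e * C n i y.
  by move: Ce; rewrite mulrAC ler_pdivlMr ?(mulrC (1 + e))//; lra.
split; last by lra.
by have : 0 < (1 + e) * (C n i y - C n i.+1 y); [lra|rewrite pmulr_rgt0//; lra].
Qed.

Lemma left_end_exists i : Bdef n.+1 i ->
  exists2 h, supp n.+1 i h & forall g, (g < h)%N -> (I g < i)%N.
Proof.
move=> /(mdb_shift_definedP hS)[//|h /and3P[hq iT iI]].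
have ex : exists h, (i <= I h)%N by exists h.
case: (ex_minnP ex) => g ig gmin; exists g; last first.
  by move=> g' g'g; rewrite ltnNge; apply/negP => /gmin; rewrite leqNgt g'g.
have gh : (g <= h)%N by exact: gmin.
rewrite /in_support ig (leq_trans gh hq) andbT/=; apply: leq_ltn_trans iT.
by rewrite leq_add2r right_count_le.
Qed.

(** The sign change bound for a single function gives a constant sign, and the function is positive
    near the left end of its support. *)
Lemma next_level_ge0 i y : y != b -> 0 <= B n.+1 i y.
Proof.
move=> yb; have [D|nD] := boolP (Bdef n.+1 i); last first.
  by rewrite /= (mdb_undef _ nD).
have [h sh hmin] := left_end_exists D; have /and3P[hq iT iI] := sh.
have i0 : (0 < i)%N := in_support_gt0 (nm : (n.+1 <= m.+1)%N) sh.
have [eta etah etaP] := next_level_left_end sh hmin ltr01.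
rewrite leNgt; apply/negP => y0.
pose z := x h + eta / 2.
have zin : x h < z < x h + eta by rewrite /z; lra.
have z0 := (etaP z zin).1.
have zb : z != b.
  by rewrite lt_eqF//; have := breakpoint_le_last hS hq; lra.
have zy : z != y by apply: contraTneq z0 => ->; rewrite -leNgt ltW.
have sgn l : sign_alternating (B n.+1 i) l -> all (predC1 b) l ->
    (size l <= 1)%N.
  move=> al; apply: (next_level_sign_changes hS nm Ln (c := fun=> 1) i0).
  rewrite (@eq_sign_alternating _ _ (B n.+1 i)) // => u _.
  by rewrite addn1 big_nat1 mul1r.
have [zy'|yz] := ltP z y.
  have := sgn [:: z; y]; rewrite /sign_alternating/= zb yb zy' !andbT.
  by rewrite (gt_eqF z0) (lt_eqF y0) pmulr_rlt0// y0 => /(_ isT isT).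
have := sgn [:: y; z]; rewrite /sign_alternating/= zb yb !andbT.
rewrite (gt_eqF z0) (lt_eqF y0) pmulr_llt0// y0 => /(_ _ isT).
by rewrite lt_neqAle yz eq_sym zy => /(_ isT).
Qed.

Lemma next_level_itv01 i y : 0 <= B n.+1 i y <= 1.
Proof.
have main z : z != b -> 0 <= B n.+1 i z <= 1.
  move=> zb; rewrite next_level_ge0// andTb.
  have [zab|] := boolP (x 0%N <= z < b); last first.
    by rewrite lt_neqAle zb andTb => zab; rewrite (mdb_shift_out hS).
  have [h hq hz] := breakpoint_interval zab.
  have [->|i0] := posnP i.
    by rewrite (mdb_shift_0 _ _ _ (nm : (n.+1 <= m.+1)%N)) ?lexx ?ler01.
  rewrite (next_level_in hS nm Ln hq i0 hz); case: ifP => // _.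
  have := cumul_itv01 hS Ln i z; have := cumul_itv01 hS Ln i.+1 z; lra.
have [->|/main//] := eqVneq y b.
rewrite /= mdbE; case: ifPn => [D|_]; last by rewrite lexx ler01.
rewrite eqxx; set F := (X in lim X).
have near01 : \forall z \near b^'-, 0 <= mdb_piece q x d k n i z <= 1.
  near=> z; have zb : z != b by rewrite lt_eqF.
  by have := main z zb; rewrite /= mdbE D (negbTE zb).
(* If the left limit at b did not exist, [lim] would return its default value 0, which is within the
   bounds. *)
have [cv|/dvgP] := pselect (cvg F); last first.
  by move=> ->; rewrite lexx ler01.
apply/andP; split.
- by apply: limr_ge => //; apply: filterS near01 => z /andP[].
- by apply: limr_le => //; apply: filterS near01 => z /andP[].
Unshelve. all: by end_near. Qed.

(** Away from b the function is a finite sum of indicators of intervals times differences of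
    monotone functions. *)
Lemma next_level_measurable i : measurable_fun setT (B n.+1 i).
Proof.
pose F y := if y == b then B n.+1 i b else
  \sum_(h <- iota 0 q.+1) (((0 < i) && (m <= d h + n))%N%:R
    * (\1_(`[x h, x h.+1[) y * (C n i y - C n i.+1 y))).
have -> : B n.+1 i = F.
  apply/funext => y; rewrite /F; case: eqVneq => [->//|yb].
  have [yab|] := boolP (x 0%N <= y < b); last first.
    rewrite lt_neqAle yb andTb => yab; rewrite (mdb_shift_out hS)//.
    rewrite big_seq big1// => h; rewrite mem_iota add0n => /andP[_ hq].
    rewrite indicE memNset ?mul0r ?mulr0//= in_itv/= => hy.
    move: yab; have := breakpoint_le hS (leq0n h) (leqW hq).
    have := breakpoint_le_last hS hq; lra.
  have [h hq hy] := breakpoint_interval yab.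
  have -> : B n.+1 i y =
      ((0 < i) && (m <= d h + n))%N%:R * (C n i y - C n i.+1 y).
    have [->|i0] := posnP i.
      by rewrite (mdb_shift_0 _ _ _ (nm : (n.+1 <= m.+1)%N)) /= mul0r.
    rewrite (next_level_in hS nm Ln hq i0 hy).
    by case: ifP => _; rewrite /= ?mul1r ?mul0r.
  rewrite (bigD1_seq h) ?iota_uniq ?mem_iota//= big_seq_cond big1 ?addr0.
    by rewrite indicE mem_set ?mul1r//= in_itv.
  move=> g; rewrite -[0%N :: _]/(iota 0 q.+1) mem_iota add0n.
  move=> /andP[/andP[_ gq] gh].
  rewrite indicE memNset ?mul0r ?mulr0//= in_itv/= => gy.
  by move/eqP: gh; apply; exact: (breakpoint_interval_inj hS gq hq gy hy).
apply: measurable_fun_ifT => //.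
  exact: measurable_fun_eqr.
apply: measurable_sum => h; apply: measurable_funM => //.
apply: measurable_funM; first exact: measurable_indic.
by apply: measurable_funB; apply: nondecreasing_measurable => //;
  exact: cumul_nondecreasing.
Qed.

Lemma next_level_integral_gt0 i : Bdef n.+1 i -> 0 < \int[mu]_y B n.+1 i y.
Proof.
move=> D; have [h sh hmin] := left_end_exists D.
have [eta /andP[et0 _] etaP] := next_level_left_end sh hmin ltr01.
have iB : mu.-integrable setT (EFin \o B n.+1 i).
  apply: (mdb_shift_integrable hS) => //; first exact: next_level_measurable.
  exact: next_level_itv01.
have B0 S : 0 <= \int[mu]_(y in S) B n.+1 i y.
  by apply: Rintegral_ge0 => y _; case/andP: (next_level_itv01 i y).
have uv : x h < x h + eta by lra.
have aux (A v u w : R) : 0 < v - u -> A - v = w -> 0 <= w -> 0 <= u -> 0 < A.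
  lra.
have := Rintegral_itv_gt0 iB uv (fun y hy => (etaP y hy).1).
rewrite -(Rintegral_itv_sub iB (ltW uv)) => gt0.
exact: (aux _ _ _ _ gt0 (Rintegral_itv_subT (x h + eta) iB) (B0 _) (B0 _)).
Qed.

Lemma regular_levelS : regular n.+1.
Proof.
split.
- exact: next_level_measurable.
- exact: next_level_itv01.
- exact: next_level_integral_gt0.
- exact: next_level_sign_changes.
- move=> i h sh hmin e e0.
  have [eta /andP[et0 eth] etaP] := next_level_left_end sh hmin e0.
  exists eta => // y hy; have [By Ce] := etaP y hy; split => //.
  have hq : (h <= q)%N by case/and3P: sh.
  have hin : x h <= y < x h.+1 by lra.
  (* The next function is 0 or C_{i+1} - C_{i+2}, so at most C_{i+1}. *)
  apply: le_trans Ce; rewrite (next_level_in hS nm Ln hq (ltn0Sn i) hin).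
  have := cumul_itv01 hS Ln i.+1 y; have := cumul_itv01 hS Ln i.+2 y.
  by case: ifP => _; lra.
Qed.
End Step.

End NextLevel.

(** * The spline basis and the basis of the derivative space *)

Section DerivativeBasis.
Context {R : realType} (q : nat) (x : nat -> R) (d k : nat -> nat).
Hypothesis hS : mdspline_data q x d k.

Local Notation I h := (mdspline_dim h d k).
Local Notation m := (mdspline_maxdeg q d).
Local Notation s := (left_knot q x d k).
Local Notation t := (right_knot q x d k).
Local Notation T h := (right_count d k h).
Local Notation N := (mdb q x d k).

Local Notation C := (cumul q x d k).
Local Notation mu := (@lebesgue_measure R).
Local Notation b := (x q.+1).

Local Notation B := (mdb_shift q x d k).
Local Notation Bdef := (mdb_shift_defined q x d k).
Local Notation regular := (regular_level q x d k).
Local Notation supp := (in_support q d k).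


Lemma regular_level0 : regular 0.
Proof.
split => //=.
- by move=> i; exact: measurable_cst.
- by move=> i y; rewrite lexx ler01.
- move=> c p r [//|u l] _ /andP[_ /=].
  by rewrite big1 ?eqxx// => i _; rewrite mulr0.
- move=> i h /and3P[hq iT iI]; exfalso.
  by move: (maxdeg_ge d hq) (left_rightE hS hq) iT iI; clear; lia.
Qed.

Lemma regular_levelP n : (n <= m.+1)%N -> regular n.
Proof.
elim: n => [_|n IH nm]; first exact: regular_level0.
exact: (regular_levelS hS nm (IH (ltnW nm))).
Qed.

Lemma mdb_basisE i y : (0 < i)%N -> x 0%N <= y < b ->
  mdb_basis q x d k i y = C m i y - C m i.+1 y.
Proof.
move=> i0 /breakpoint_interval[h hq hy].
have /= := next_level_in hS (leqnn m) (regular_levelP (leqnSn m)) hq i0 hy.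
by rewrite leq_addl.
Qed.

Lemma cumul_beyond i y : (I q < i)%N -> x 0%N <= y < b -> C m i y = 0.
Proof.
move=> qi /breakpoint_interval[h hq hy].
apply: (cumul_left hS (leqnn m) (regular_levelP (leqnSn m)) hq _ hy).
exact: leq_ltn_trans (left_count_le _ _ hq) qi.
Qed.

Lemma mdb_basis_gt0 i h : (h <= q)%N -> (T h < i <= I h)%N ->
  exists2 y, x 0%N <= y < b & 0 < mdb_basis q x d k i y.
Proof.
move=> hq /andP[hT hI]; have rm := regular_levelP (leqnSn m).
have D : Bdef m.+1 i.
  apply/(mdb_shift_definedP hS) => //; exists h.
  by rewrite /in_support hq hI ltn_add2r hT.
have [g sg gmin] := left_end_exists hS (leqnn m) D.
have [eta etag etaP] := next_level_left_end hS (leqnn m) rm sg gmin ltr01.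
have gq : (g <= q)%N by case/and3P: sg.
exists (x g + eta / 2).
  have := breakpoint_le_last hS gq.
  have := breakpoint_le hS (leq0n g) (leqW gq); lra.
by have [|] := etaP (x g + eta / 2); first by lra.
Qed.

Lemma mdb_deriv_basis_out i y : ~~ (x 0%N <= y <= b) ->
  mdb_deriv_basis q x d k i y = 0.
Proof. exact: mdb_out. Qed.

Lemma Rintegral_mdb_deriv_basis i :
  \int[mu]_(y in `[x 0%N, b]) mdb_deriv_basis q x d k i y
  = \int[mu]_y mdb_deriv_basis q x d k i y.
Proof.
rewrite Rintegral_mkcond; apply: eq_Rintegral => y _; rewrite patchE.
case: ifPn => //; rewrite notin_setE/= in_itv/= => /negP yab.
by rewrite mdb_deriv_basis_out.
Qed.

Hypothesis m0 : (0 < m)%N.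

(** For m = 0 the truncated predecessor would give level 0 of [mdb] instead of the empty level. *)
Lemma mdb_deriv_basis_shift i : mdb_deriv_basis q x d k i = B m i.+1.
Proof. by rewrite /mdb_deriv_basis /mdb_shift; case: (m) m0. Qed.

Lemma integrable_mdb_deriv_basis i D : measurable D ->
  mu.-integrable D (EFin \o mdb_deriv_basis q x d k i).
Proof.
rewrite mdb_deriv_basis_shift.
exact: integrable_level (regular_levelP (leqnSn m)) _ _.
Qed.

Lemma mdb_deriv_basis_integral_gt0 i h : (h <= q)%N ->
  ((T h).+1 < i.+1 <= I h)%N -> 0 < \int[mu]_y mdb_deriv_basis q x d k i y.
Proof.
move=> hq /andP[hT hI]; rewrite mdb_deriv_basis_shift.
apply: (level_integral_gt0 (regular_levelP (leqnSn m))).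
apply/(mdb_shift_definedP hS); first exact: leqnSn.
by exists h; rewrite /in_support hq hI addnS -addSn ltn_add2r hT.
Qed.

Lemma cumul_mdb_deriv_basis i h y : (h <= q)%N ->
  ((T h).+1 < i.+1 <= I h)%N ->
  \int[mu]_(z in `]-oo, y]) mdb_deriv_basis q x d k i z
  = (\int[mu]_z mdb_deriv_basis q x d k i z) * C m i.+1 y.
Proof.
move=> hq hi; have := mdb_deriv_basis_integral_gt0 hq hi.
have /andP[hT hI] := hi; rewrite mdb_deriv_basis_shift => i0.
rewrite (cumul_defined hS (regular_levelP (leqnSn m))).
  by rewrite mulVKf// gt_eqF.
apply/(mdb_shift_definedP hS); first exact: leqnSn.
by exists h; rewrite /in_support hq hI addnS -addSn ltn_add2r hT.
Qed.

End DerivativeBasis.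

(** * Knot insertion *)

Section KnotInsertion.
Context {R : realType} (q : nat) (x : nat -> R) (d k khat : nat -> nat).
Context (j : nat).
Hypothesis hS : mdspline_data q x d k.
Hypothesis hShat : mdspline_data q x d khat.
Hypothesis hj : (1 <= j <= q)%N.
Hypothesis hkj : k j = (khat j).+1.
Hypothesis hki : forall i, (1 <= i <= q)%N -> i != j -> khat i = k i.

Local Notation mu := (@lebesgue_measure R).
Local Notation m := (mdspline_maxdeg q d).
Local Notation C := (cumul q x d k m).
Local Notation Ch := (cumul q x d khat m).
Local Notation K := (mdspline_dim q d k).

(** Lowering k_j by one adds one copy of x_j to each extended partition. *)
Lemma insertion_counts h : (h <= q)%N ->
  mdspline_dim h d khat = (mdspline_dim h d k + (j <= h))%N
  /\ right_count d khat h = (right_count d k h + (j <= h))%N.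
Proof.
rewrite /mdspline_dim /right_count; elim: h => [|h IH] hq.
  have -> : (j <= 0)%N = false by move: hj; clear; lia.
  by rewrite !big_geq ?addn0.
have [IH1 IH2] := IH (ltnW hq).
rewrite !(@big_nat_recr _ _ _ h.+1)//=.
have := hS.2 h.+1 hq; have := hki (i := h.+1) hq.
move: IH1 IH2 hkj; case: (eqVneq h.+1 j) => [<-|hj'].
  by rewrite ltnn leqnn /=; clear; lia.
rewrite (leq_eqVlt j h.+1) eq_sym (negbTE hj') ltnS /=.
by move=> IH1 IH2 _ /(_ isT) -> _; move: IH1 IH2; clear; lia.
Qed.

(** Descending induction on r, each step adding the insertion relation at r. It starts at r = K + 1,
    where C_{K+1}, alpha_{K+1} and Chat_{K+2} all vanish. *)
Lemma cumul_insertion (alpha : nat -> R) :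
  (forall i, (1 <= i <= K)%N -> forall y, y \in `[x 0%N, x q.+1] ->
     mdb_basis q x d k i y = alpha i * mdb_basis q x d khat i y
       + (1 - alpha i.+1) * mdb_basis q x d khat i.+1 y) ->
  alpha K.+1 = 0 ->
  forall r y, (1 <= r <= K.+1)%N -> x 0%N <= y < x q.+1 ->
    C r y = alpha r * Ch r y + (1 - alpha r) * Ch r.+1 y.
Proof.
move=> rel aK r y /andP[r1 rK] hy.
have [Khat _] := insertion_counts (leqnn q).
have yin : y \in `[x 0%N, x q.+1] by rewrite in_itv/=; lra.
rewrite -(subKn rK); have : (K.+1 - r <= K)%N by lia.
elim: (K.+1 - r)%N => [|e IH] eK.
  rewrite subn0 aK (cumul_beyond hS)// mul0r add0r.
  rewrite (cumul_beyond hShat) ?mulr0//.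
  by rewrite Khat; case/andP: hj => _ ->; rewrite addn1.
have ie : (K.+1 - e = (K - e).+1)%N by rewrite subSn// ltnW.
rewrite subSS; have i1 : (0 < K - e)%N by rewrite subn_gt0.
have := rel (K - e)%N; rewrite i1 leq_subr => /(_ isT y yin).
rewrite !mdb_basisE//; have := IH (ltnW eK); rewrite ie.
move: (C _ _) (C _ _) (Ch _ _) (Ch _ _) (Ch _ _) (alpha _) (alpha _).
by move=> c1 c2 e1 e2 e3 a1 a2; lra.
Qed.

Lemma coefficient_formula (alpha alpha1 : nat -> R) r :
  (forall i, (1 <= i <= K)%N -> forall y, y \in `[x 0%N, x q.+1] ->
     mdb_basis q x d k i y = alpha i * mdb_basis q x d khat i y
       + (1 - alpha i.+1) * mdb_basis q x d khat i.+1 y) ->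
  alpha K.+1 = 0 ->
  (forall y, y \in `[x 0%N, x q.+1] ->
     mdb_deriv_basis q x d k r y = alpha1 r * mdb_deriv_basis q x d khat r y
       + (1 - alpha1 r.+1) * mdb_deriv_basis q x d khat r.+1 y) ->
  (right_count d k j < r <= right_count d k j + k j)%N ->
  alpha r.+1 = alpha1 r *
    (\int[mu]_y mdb_deriv_basis q x d khat r y
     / \int[mu]_y mdb_deriv_basis q x d k r y).
Proof.
move=> rel aK rel1 rj; have /andP[j1 jq] := hj.
have [Ij Tj] := insertion_counts jq; rewrite leqnn in Ij Tj.
have j1q : (j.-1 <= q)%N by lia.
have [Ij1 Tj1] := insertion_counts j1q.
have jj : (j <= j.-1)%N = false by move: j1; clear; lia.
rewrite jj !addn0 in Ij1 Tj1.
have IT := left_rightE hS jq; have IT1 := left_rightE hS j1q.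
have kd := hS.2 j hj.
have Tjj : right_count d k j = (right_count d k j.-1 + (d j.-1 - k j))%N.
  by rewrite /right_count -(prednK j1) [in LHS]big_nat_recr//= prednK.
(* The continuity k_j is at least 1 and at most d_j. *)
have m0 : (0 < m)%N.
  by apply: leq_trans (maxdeg_ge d jq); move: kd hkj; clear; lia.
have hr : ((right_count d k j).+1 < r.+1 <= mdspline_dim j d k)%N.
  by move: IT rj kd; clear; lia.
(* Nhat^(1)_r is looked for on the interval ending at x_j: the new knot raises the right count at
   x_j, and for r = T_j + 1, with T_j the count before insertion, the function is zero on the
   interval starting there. *)
have hr1 : ((right_count d khat j.-1).+1 < r.+1 <= mdspline_dim j.-1 d khat)%N.
  by rewrite Ij1 Tj1; move: IT1 Tjj rj kd; clear; lia.
have hr2 : ((right_count d khat j).+1 < r.+2 <= mdspline_dim j d khat)%N.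
  by rewrite Ij Tj; move: IT rj kd; clear; lia.
have hr3 : (right_count d khat j.-1 < r.+1 <= mdspline_dim j.-1 d khat)%N.
  by move: hr1; clear; lia.
have rK : (1 <= r.+1 <= K.+1)%N.
  have := left_count_le d k jq; move: hr; clear; lia.
have [y hy Ny] := mdb_basis_gt0 hShat j1q hr3.
rewrite (mdb_basisE hShat)// in Ny.
have relT z : mdb_deriv_basis q x d k r z
    = alpha1 r * mdb_deriv_basis q x d khat r z
      + (1 - alpha1 r.+1) * mdb_deriv_basis q x d khat r.+1 z.
  have [/rel1//|] := boolP (z \in `[x 0%N, x q.+1]).
  rewrite in_itv/= => zab.
  by rewrite !mdb_deriv_basis_out// !mulr0 addr0.
have relI D : measurable D -> \int[mu]_(z in D) mdb_deriv_basis q x d k r z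
    = alpha1 r * \int[mu]_(z in D) mdb_deriv_basis q x d khat r z
      + (1 - alpha1 r.+1)
        * \int[mu]_(z in D) mdb_deriv_basis q x d khat r.+1 z.
  move=> mD; under eq_Rintegral do rewrite relT.
  rewrite RintegralD//; last 2 first.
  - apply: integrable_scale => //.
    exact: (integrable_mdb_deriv_basis hShat m0).
  - apply: integrable_scale => //.
    exact: (integrable_mdb_deriv_basis hShat m0).
  by rewrite !RintegralZl//; exact: (integrable_mdb_deriv_basis hShat m0).
have w0 := mdb_deriv_basis_integral_gt0 hS m0 jq hr.
have := relI _ (measurable_itv `]-oo, y]).
rewrite (cumul_mdb_deriv_basis hS m0 y jq hr).
rewrite (cumul_mdb_deriv_basis hShat m0 y j1q hr1).
rewrite (cumul_mdb_deriv_basis hShat m0 y jq hr2).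
have := relI _ measurableT.
rewrite (cumul_insertion rel aK rK hy).
(* From here v, u, w are the integrals of N^(1)_r, Nhat^(1)_r, Nhat^(1)_{r+1}, and below c2, c1 are
   the values of Chat_{r+1}, Chat_{r+2} at y, whose difference Nhat_{r+1,m}(y) is positive and
   cancels. *)
move: (Rintegral _ _ _) (Rintegral _ _ _) (Rintegral _ _ _) w0 => w u v w0.
move: (Ch _ _) (Ch _ _) Ny (alpha _) (alpha1 _) (alpha1 _) => c1 c2 c12 a a1 a2.
move=> wE; rewrite (mulrA (1 - a1)).
rewrite (_ : (1 - a1) * w = v - a2 * u); last by lra.
move=> wC; have /eqP : (v * a - a2 * u) * (c2 - c1) = 0 by lra.
rewrite mulf_eq0 (gt_eqF c12) orbF subr_eq0 => /eqP va.
by rewrite mulrA -va mulrC mulKf// gt_eqF.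
Qed.

End KnotInsertion.

(** * The coefficients as ratios of integrals *)

Unset Implicit Arguments.

Theorem proposition4 (R : realType) (q : nat) (x : nat -> R)
    (d k khat : nat -> nat) (j l : nat) (alpha alpha1 : nat -> R)
    (hS : mdspline_data q x d k) (hShat : mdspline_data q x d khat)
    (hj : (1 <= j <= q)%N)
    (hkj : k j = (khat j).+1)
    (hki : forall i, (1 <= i <= q)%N -> i != j -> khat i = k i)
    (hl : (1 <= l <= mdspline_dim q d k)%N)
    (hlj : left_knot q x d k l <= x j
           < Num.min (left_knot q x d k l.+1) (x q.+1))
    (halpha : reverse_knot_insertion (x 0%N) (x q.+1) (mdspline_dim q d k)
       l (d j) (k j) (mdb_basis q x d k) (mdb_basis q x d khat) alpha)
    (halpha1 : reverse_knot_insertion (x 0%N) (x q.+1) (mdspline_dim q d k).-1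
       l.-1 (d j).-1 (k j).-1
       (mdb_deriv_basis q x d k) (mdb_deriv_basis q x d khat) alpha1) :
  forall i, (l - d j + 1 <= i <= l - d j + k j)%N ->
    alpha i = alpha1 i.-1 *
      (\int[@lebesgue_measure R]_(y in `[x 0%N, x q.+1])
         mdb_deriv_basis q x d khat i.-1 y
       / \int[@lebesgue_measure R]_(y in `[x 0%N, x q.+1])
           mdb_deriv_basis q x d k i.-1 y).
Proof.
move=> i ij; have [j1 jq] := andP hj.
have [_ _ azero rel] := halpha; have [_ _ _ rel1] := halpha1.
have IT := left_rightE hS jq; have kd := hS.2 j hj.
(* The index l is that of the last left knot equal to x_j or before it, so l - d_j = T_j + 1 and the
   range of i - 1 is T_j + 1, ..., T_j + k_j. *)
have lI : l = mdspline_dim j d k.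
  apply/eqP; rewrite eqn_leq; apply/andP; split.
    rewrite leqNgt; apply/negP => /(left_knot_ge hS jq) h.
    by have := hS.1 j jq; move: hlj => /andP[h1 _]; lra.
  rewrite leqNgt; apply/negP => Il; move: hlj => /andP[_].
  rewrite lt_min ltNge => /andP[/negP h _]; apply: h.
  by apply: (left_knot_le hS jq); rewrite /= Il.
have jK := left_count_le d k jq.
have i0 : (0 < i)%N by move: ij; clear; lia.
rewrite !(Rintegral_mdb_deriv_basis hS) ?(Rintegral_mdb_deriv_basis hShat).
rewrite -[in LHS](prednK i0).
apply: (coefficient_formula hS hShat hj hkj hki rel).
- by apply: azero; move: jK lI kd; clear; lia.
- by apply: rel1; move: jK lI kd IT ij; clear; lia.
- by move: lI kd IT ij; clear; lia.
Qed.
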